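(* Let $p>1$, $s=\frac1{p-1}$ and $q=\frac{p}{p-1}=s+1$. Assume that $\mathbf E[Z^q]<+\infty$. Then there is a constant $c_p>0$, depending only on the law $\mu$ and on $p$, such that for all $n\ge 1$ $$c_p\,(a_n)^{-1/s}\le \mathbf E[C_n]\le (a_n)^{-1/s},\qquad a_n:=\sum_{k=1}^n (mR_n)^{-ks},$$ where $C_n$ is the $p$-conductance between the root and the leaves of $T_n$ equipped with resistances $R_v=(R_n)^{-|v|}$. Additionally, the sequence of random variables $(a_n^{1/s}C_n)_{n\ge1}$ is tight in $(0,+\infty)$.
   Context: Tree. $\mu$ is a probability distribution on $\{0,1,2,\dots\}$ with $\mu(0)=0$, $\mu(1)<1$; $Z\sim\mu$ and $m:=\mathbf E[Z]<\infty$ (so $m>1$). $T$ is the Galton--Watson tree with offspring law $\mu$ and root $\rho$; $|v|$ is the distance from $v$ to $\rho$; $T_n$ is the subtree of vertices at distance at most $n$ from the root, and its leaves are $\partial T_n=\{v:|v|=n\}$. $\mathbf P,\mathbf E$ refer to the randomness of the tree. Resistances. $(R_n)_{n\ge1}$ is a deterministic sequence of positive numbers. For each $n$, the edge of $T_n$ joining a vertex $v\ne\rho$ to its parent has resistance $R_v:=(R_n)^{-|v|}$ ($R_n$ is fixed along $T_n$ but may depend on $n$). $p$-conductance. For a graph $G=(V,E)$ with resistances $(R(e))_{e\in E}$ and disjoint $A,B\subset V$, a unit flow from $A$ to $B$ is a real function $\theta$ on directed edges with $\theta(-\vec e)=-\theta(\vec e)$, $\sum_{y\sim x}\theta(\vec{xy})=0$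 for all $x\in V\setminus(A\cup B)$, and $\sum_{x\in A,\,y\notin A,\,x\sim y}\theta(\vec{xy})=1$. Its $p$-energy is $\mathcal E_p(\theta)=\sum_{e\in E}R(e)^{\frac1{p-1}}|\theta(e)|^{\frac p{p-1}}$. Define $\mathcal R_p(A\leftrightarrow B)=\inf_\theta \mathcal E_p(\theta)^{p-1}$, the infimum being over unit flows $\theta$ from $A$ to $B$, and $\mathcal C_p(A\leftrightarrow B)=\mathcal R_p(A\leftrightarrow B)^{-1}$. Then $C_n:=\mathcal C_p(\rho\leftrightarrow\partial T_n)$, a random variable depending on $T_n$. Tight in $(0,+\infty)$ means: for every $\varepsilon>0$ there is a compact interval $I\subset(0,+\infty)$ such that each variable of the sequence belongs to $I$ with probability at least $1-\varepsilon$. *)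

(* Defs.v *)
From HB Require Import structures.
From mathcomp Require Import all_boot all_order all_algebra.
From mathcomp Require Import all_classical all_reals all_analysis.
Set Implicit Arguments.
Unset Strict Implicit.
Unset Printing Implicit Defensive.
Import Order.TTheory GRing.Theory Num.Theory.
Import numFieldNormedType.Exports.
Local Open Scope classical_set_scope.
Local Open Scope ring_scope.

Section p_conductance.
Context {R : realType} {V : finType}.

(* [adj] is a symmetric adjacency relation and [res] is symmetric on adjacent
   pairs. The values of a flow on pairs that are not edges are irrelevant. *)
Variables (adj : rel V) (res : V -> V -> R) (p : R).

Definition unit_flow (A B : {set V}) (theta : V -> V -> R) : Prop :=
  [/\ forall x y, adj x y -> theta y x = - theta x y,
      forall x, x \notin A :|: B -> \sum_(y | adj x y) theta x y = 0
    & \sum_(x in A) \sum_(y | (y \notin A) && adj x y) theta x y = 1].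

(* The double sum runs over directed edges and sees every edge twice, hence
   the factor 1/2. *)
Definition p_energy (theta : V -> V -> R) : R :=
  2^-1 * \sum_x \sum_(y | adj x y)
           res x y `^ (p - 1)^-1 * `|theta x y| `^ (p / (p - 1)).

(* Extended-real valued: the resistance is +oo when there is no unit flow, and
   the inverse on \bar R exchanges 0 and +oo. *)
Definition p_resistance (A B : {set V}) : \bar R :=
  ereal_inf [set (p_energy theta `^ (p - 1))%:E | theta in unit_flow A B].

Definition p_conductance (A B : {set V}) : \bar R := ((p_resistance A B)^-1)%E.

End p_conductance.

Section gw_tree.

(* Ulam-Harris labelling: the root is [::] and the children of v are the words
   rcons v i with i < z v, where z v is the number of children of v. *)
Fixpoint gw_level (z : seq nat -> nat) (n : nat) : seq (seq nat) :=
  if n is k.+1 then [seq rcons v i | v <- gw_level z k, i <- iota 0 (z v)]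
  else [:: [::]].

Definition gw_tree (z : seq nat -> nat) (n : nat) : seq (seq nat) :=
  flatten [seq gw_level z k | k <- iota 0 n.+1].

Definition is_parent (u v : seq nat) : bool :=
  (v != [::]) && (u == take (size v).-1 v).

Definition tree_adj : rel (seq nat) :=
  fun u v => is_parent u v || is_parent v u.

(* The resistance r^-|v| of the edge joining v to its parent: v is the deeper
   of the two endpoints. *)
Definition tree_res {R : realType} (r : R) (u v : seq nat) : R :=
  r ^- maxn (size u) (size v).

Definition tree_conductance {R : realType} (p r : R) (z : seq nat -> nat)
    (n : nat) : \bar R :=
  let V : finType := seq_sub (gw_tree z n) in
  p_conductance (fun x y : V => tree_adj (val x) (val y))
    (fun x y : V => tree_res r (val x) (val y)) p
    [set x : V | val x == [::]]%SET [set x : V | size (val x) == n]%SET.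

End gw_tree.

Section probability.
Context {R : realType} {d : measure_display} {Omega : measurableType d}.
Variable P : probability Omega R.

Definition mutually_independent (I : choiceType) (X : I -> {RV P >-> nat}) :
    Prop :=
  forall (s : seq I) (B : I -> set nat), uniq s ->
    P (\bigcap_(i in [set` s]) (X i @^-1` B i)) =
    (\prod_(i <- s) P (X i @^-1` B i))%E.

(* The offspring numbers of a Galton-Watson tree: i.i.d. with law mu, indexed
   by all potential vertices. *)
Definition gw_offspring (mu : probability nat R)
    (Z : seq nat -> {RV P >-> nat}) : Prop :=
  (forall v (B : set nat), distribution P (Z v) B = mu B) /\
  mutually_independent Z.

(* Tightness in (0, +oo) of the sequence (X n) for n >= 1. *)
Definition tight_pos (X : nat -> Omega -> \bar R) : Prop :=
  forall eps : R, 0 < eps ->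
    exists a b : R, [/\ 0 < a, a <= b &
      forall n : nat, (1 <= n)%N ->
        ((1 - eps)%:E <= P [set w | (a%:E <= X n w)%E /\ (X n w <= b%:E)%E])%E].

End probability.

Definition gw_mean {R : realType} (mu : probability nat R) : \bar R :=
  (\int[mu]_k (k%:R : R)%:E)%E.

Definition gw_a {R : realType} (m s r : R) (n : nat) : R :=
  \sum_(1 <= k < n.+1) (m * r) `^ (- (k%:R * s)).

(* Main.v *)
From HB Require Import structures.
Require Import Defs.
From mathcomp Require Import all_boot all_order all_algebra.
From mathcomp Require Import all_classical all_reals all_analysis.
From mathcomp Require Import measurable_realfun ring lra.
Import Order.TTheory GRing.Theory Num.Theory.
Import numFieldNormedType.Exports.
Set Implicit Arguments.
Unset Strict Implicit.
Unset Printing Implicit Defensive.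
Local Open Scope classical_set_scope.
Local Open Scope ring_scope.


(** Let [W_n] be the number of leaves of [T_n] divided by its mean [m ^ n], and
    let [W_v] be the same quantity for the part of [T_n] below a vertex [v].
    Both bounds on [E C_n] come from trial objects whose energy is a sum over
    generations, so that only first moments have to be computed.

    Upper bound. A unit flow carries a total of 1 across every level
    ([unit_flow_level]). Hence, for positive weights [delta_k] of sum 1, the sum
    of [delta_|v|] times the flow above [v] is at least 1, and convexity of
    [y |-> y ^ q] turns this into
      [C_n <= sum_k r ^ k * delta_k ^ p * |dT_k|]   ([tree_conductance_le]).
    The mean of [|dT_k|] is [m ^ k]; with [delta_k] proportional to
    [(m r) ^ (- k s)] the mean of the right-hand side is [a_n ^ (- 1/s)]
    ([integral_cut_energy]).

    Lower bound. The unit flow that is uniform on the leaves shows that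
      [C_n >= W_n ^ p * X_n ^ (- 1/s)]   ([tree_conductance_ge_code])
    where [X_n = sum_k r ^ (- k s) * m ^ (- k q) * sum_(|v| = k) W_v ^ q].
    By the many-to-one formula [E X_n <= K * a_n], where [K] bounds all the
    moments [E (W_n ^ q)]. Since [E W_n = 1], integrating the pointwise bound
      [W <= X / tau + tau ^ (1/s) * (W ^ p * X ^ (- 1/s))]
    with [tau = 2 K a_n] yields [E C_n >= (2 K a_n) ^ (- 1/s) / 2].

    The moments ([moment_bound]). Given the number of children of the root,
    [W_(n+1)] is [1/m] times a sum of independent copies of [W_n]. When the sum
    is raised to the power [q], the diagonal terms contribute
    [m ^ (1 - q) < 1] times [E (W_n ^ q)], up to a factor close to 1, and the
    others are products of independent factors of lower order
    ([powR_sum_le]); so [E (W_n ^ q)] satisfies a contracting recursion.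

    Tightness. Markov's inequality for the cut bound controls [C_n] from above.
    From below it remains to see that [W_n] is small with small probability
    only, uniformly in [n] ([small_norm_population]). The moment bound gives
    [P (W_n < 1/2) <= x < 1] for all [n]. If [W_(k+j) < m ^ (- k) / 2], then every
    vertex [v] of generation [k] has [W_v < 1/2], and, since no vertex is
    childless and some have several children, the probability of that decays
    exponentially in [k].

    All the randomness up to height [n] is stored in one natural number,
    [tree_code n]. Its law is determined by a recursion in [n]: draw [k] from
    [mu], then draw [k] independent codes of height [n]
    ([integral_tree_lawS]). *)

(** * Real powers *)

(** Young's inequality with one factor equal to 1: the graph of a power lies
    above its tangent line at 1. Jensen-type bounds follow by summation. *)
Lemma bernoulli_powR {R : realType} (y q : R) : 0 <= y -> 1 < q ->
  q * y - (q - 1) <= y `^ q.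
Proof.
move=> y0 q1; have q0 : 0 < q by exact: lt_trans q1.
have q10 : 0 < q - 1 by rewrite subr_gt0.
have := @conjugate_powR R y 1 q (q / (q - 1)) y0 ler01 q0.
rewrite divr_gt0 // => /(_ isT); rewrite mulr1 powR1 mul1r invf_div.
have -> : q^-1 + (q - 1) / q = 1 by rewrite mulrBl divff ?mul1r ?gt_eqF // addrC subrK.
move=> /(_ erefl) /(ler_wpM2l (ltW q0)).
rewrite mulrDr !mulrA [q * (q - 1)]mulrC mulfK ?gt_eqF //.
by rewrite [q * _ / q]mulrAC divff ?gt_eqF // mul1r lerBlDr.
Qed.

Lemma powR_exp {R : realType} (x a : R) : 0 < x -> x `^ a = expR (a * ln x).
Proof. by move=> x0; rewrite /powR gt_eqF. Qed.

Lemma powR_invl {R : realType} (x a : R) : 0 <= x -> x^-1 `^ a = (x `^ a)^-1.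
Proof.
by move=> x0; rewrite -(powR_inv1 x0) -[RHS]powR_inv1 ?powR_ge0 // powRAC.
Qed.

Section powR_inequalities.
Context {R : realType}.
Implicit Types (x y a b s q A C D eps : R).

Lemma ler_powRl s x y : 0 <= s -> 0 <= x -> x <= y -> x `^ s <= y `^ s.
Proof.
by move=> s0 x0 xy; apply: ge0_ler_powR; rewrite // nnegrE // (le_trans x0).
Qed.

Lemma powR_succ s x : 0 < s -> 0 <= x -> x `^ (s + 1) = x * x `^ s.
Proof.
move=> s0 x0; have := mulr_powRB1 x0 (addr_gt0 s0 ltr01).
by rewrite addrK => ->.
Qed.

(** Above the threshold [eps^-1] the first term dominates, below it the
    constant does. *)
Lemma powR_le_eps_succ s eps : 0 < s -> 0 < eps ->
  exists C, 0 <= C /\ forall y, 0 <= y -> y `^ s <= eps * y `^ (s + 1) + C.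
Proof.
move=> s0 e0; exists (eps^-1 `^ s); split=> [|y y0]; first exact: powR_ge0.
have [ye|ye] := lerP y eps^-1.
  by rewrite ler_wpDl ?mulr_ge0 ?powR_ge0 ?(ltW e0) ?ler_powRl // ltW.
rewrite ler_wpDr ?powR_ge0 // powR_succ // mulrA ler_peMl ?powR_ge0 //.
by rewrite -(mulfV (lt0r_neq0 e0)) ler_pM2l // ltW.
Qed.

(** Truncation of a first moment by a higher moment. *)
Lemma le_eps_powR_succ s eps : 0 < s -> 0 < eps ->
  exists C, 0 <= C /\ forall y, 0 <= y -> y <= eps * y `^ (s + 1) + C.
Proof.
move=> s0 e0; exists (eps^-1 `^ s^-1); split=> [|y y0]; first exact: powR_ge0.
have [ye|ye] := lerP (y `^ s) eps^-1.
  rewrite ler_wpDl ?mulr_ge0 ?powR_ge0 ?(ltW e0) //.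
  rewrite -[leLHS](powRr1 y0) -(mulfV (lt0r_neq0 s0)) powRrM.
  by rewrite ler_powRl ?powR_ge0 // invr_ge0 ltW.
rewrite ler_wpDr ?powR_ge0 // powR_succ // mulrCA ler_peMr //.
by rewrite -(mulfV (lt0r_neq0 e0)) ler_pM2l // ltW.
Qed.

(** Either [b] is at most a small multiple of [a] and is absorbed by the factor
    [A], or [a] is at most a multiple of [b]. *)
Lemma powR_add_le s A : 0 < s -> 1 < A ->
  exists D, 0 <= D /\
    forall a b, 0 <= a -> 0 <= b -> (a + b) `^ s <= A * a `^ s + D * b `^ s.
Proof.
move=> s0 A1; have A0 : 0 < A by exact: lt_trans A1.
have [k k0 AE] : exists2 k, 0 < k & A = (1 + k) `^ s.
  exists (A `^ s^-1 - 1).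
    have := gt0_ltr_powR (_ : 0 < s^-1) (_ : 1 \in Num.nneg) (_ : A \in Num.nneg) A1.
    by rewrite powR1 subr_gt0; apply; rewrite ?invr_gt0 // nnegrE // ltW.
  by rewrite addrC subrK -powRrM mulVf ?gt_eqF // powRr1 // ltW.
exists ((1 + k^-1) `^ s); split=> [|a b a0 b0]; first exact: powR_ge0.
have [bk|bk] := lerP b (k * a).
  rewrite ler_wpDr ?mulr_ge0 ?powR_ge0 // AE.
  rewrite -powRM // ?addr_ge0 // ?(ltW k0) //.
  by rewrite ler_powRl ?addr_ge0 // ?(ltW s0) // mulrDl mul1r lerD2l.
rewrite ler_wpDl ?mulr_ge0 ?powR_ge0 ?(ltW A0) //.
rewrite -powRM // ?addr_ge0 // ?invr_ge0 ?(ltW k0) //.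
rewrite ler_powRl ?addr_ge0 ?(ltW s0) // mulrDl mul1r addrC lerD2l.
by rewrite -(ler_pM2l k0) mulrA mulfV ?gt_eqF // mul1r ltW.
Qed.

(** Jensen's inequality for the uniform law on [z] points, the points outside
    [J] carrying the value 0: sum the tangent lines at the mean. *)
Lemma jensen_powR (I : finType) (J : pred I) (x : I -> R) q z :
  1 < q -> (forall i, 0 <= x i) -> (#|J| <= z)%N ->
  ((\sum_(i | J i) x i) / z%:R) `^ q <= (\sum_(i | J i) x i `^ q) / z%:R.
Proof.
move=> q1 x0 Jz; set a := _ / _; have q0 : 0 < q by exact: lt_trans q1.
have a0 : 0 <= a by rewrite divr_ge0 ?sumr_ge0.
have [a00|an0] := eqVneq a 0.
  rewrite a00 powR0 ?gt_eqF // divr_ge0 ?sumr_ge0 // => i _; exact: powR_ge0.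
have ap : 0 < a by rewrite lt_def an0.
have zp : 0 < z%:R :> R.
  by rewrite lt_def ler0n andbT; apply: contraNneq an0 => z0; rewrite /a z0 invr0 mulr0.
rewrite ler_pdivlMr // -ler_pdivlMl ?powR_gt0 // mulr_sumr.
apply: (@le_trans _ _ (\sum_(i | J i) (q * (x i / a) - (q - 1)))).
  rewrite big_split /= sumrN -mulr_sumr -mulr_suml sumr_const.
  have -> : (\sum_(i | J i) x i) / a = z%:R.
    rewrite /a invf_div mulrCA mulfV ?mulr1 //.
    by apply: contraNneq an0 => S0; rewrite /a S0 mul0r.
  rewrite -mulr_natr lerBrDr.
  have : (#|J|%:R : R) <= z%:R by rewrite ler_nat.
  move/(ler_wpM2l (_ : 0 <= q - 1)); rewrite subr_ge0 => /(_ (ltW q1)).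
  by rewrite !mulrBl; lra.
apply: ler_sum => i _; apply: le_trans (bernoulli_powR _ q1) _.
  by rewrite divr_ge0.
by rewrite powRM ?invr_ge0 // -powR_inv1 // powRAC powR_inv1 ?powR_ge0 // mulrC.
Qed.

(** The off-diagonal part of a double sum (see [cross_sumE]); the recursive form
    can be integrated one entry at a time. *)
Fixpoint cross_sum q (l : seq R) : R :=
  if l is x :: l' then
    x * \sum_(y <- l') y `^ q + x `^ q * \sum_(y <- l') y + cross_sum q l'
  else 0.

Lemma cross_sumE q (l : seq R) : cross_sum q l =
  \sum_(i < size l) \sum_(j < size l | j != i) l`_i * l`_j `^ q.
Proof.
elim: l => [|x l IH] /=; first by rewrite big_ord0.
rewrite big_ord_recl -addrA; congr (_ + _).
  rewrite [RHS]big_mkcond big_ord_recl /= add0r.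
  by rewrite mulr_sumr (big_nth 0) big_mkord; apply: eq_bigr.
rewrite IH [X in X + _]mulr_sumr (big_nth 0) big_mkord -big_split /=.
apply: eq_bigr => i _; rewrite [RHS]big_mkcond big_ord_recl /=; congr (_ + _).
  by rewrite mulrC.
by rewrite -big_mkcond; apply: eq_bigl.
Qed.

Lemma cross_sum_ge0 q (l : seq R) :
  (forall x, x \in l -> 0 <= x) -> 0 <= cross_sum q l.
Proof.
elim: l => //= x l IH l0; have x0 : 0 <= x by rewrite l0 ?mem_head.
have {}l0 y : y \in l -> 0 <= y by move=> yl; rewrite l0 // in_cons yl orbT.
rewrite !addr_ge0 ?mulr_ge0 ?powR_ge0 ?IH //.
  by apply: sumr_ge0 => y _; exact: powR_ge0.
by rewrite big_seq; apply: sumr_ge0.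
Qed.

(** In [S ^ (s + 1) = \sum_i x_i * S ^ s], split [S] into [x_i] and the rest. The
    diagonal part costs a factor [A] as close to 1 as desired. In the other part
    [x_i] and the rest are independent when the entries are, and the power [s] of
    the rest is traded for a small multiple of the power [s + 1]. The constant
    [D] does not depend on [eps], which can thus be chosen in terms of [D]. *)
Lemma powR_sum_le s A : 0 < s -> 1 < A ->
  exists D, 0 <= D /\ forall eps, 0 < eps -> exists C, 0 <= C /\
  forall l : seq R, (forall x, x \in l -> 0 <= x) ->
   (\sum_(x <- l) x) `^ (s + 1) <= A * \sum_(x <- l) x `^ (s + 1) +
     D * (size l)%:R `^ s *
       (eps / (size l)%:R * cross_sum (s + 1) l + C * \sum_(x <- l) x).
Proof.
move=> s0 A1; have [D [D0 HD]] := powR_add_le s0 A1.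
exists D; split=> // eps e0; have [C [C0 HC]] := powR_le_eps_succ s0 e0.
exists C; split=> // l l0; set z := size l.
have {}l0 i : 0 <= l`_i.
  by have [il|il] := ltnP i (size l); [rewrite l0 ?mem_nth | rewrite nth_default].
have nthE (F : R -> R) : \sum_(x <- l) F x = \sum_(i < z) F l`_i.
  by rewrite (big_nth 0) big_mkord.
rewrite !nthE cross_sumE -/z.
set S := \sum_(i < z) l`_i.
have S0 : 0 <= S by apply: sumr_ge0.
rewrite powR_succ // {1}/S mulr_suml 2!mulr_sumr mulr_sumr -big_split mulr_sumr -big_split /=.
apply: ler_sum => i _.
pose T := \sum_(j < z | j != i) l`_j.
have T0 : 0 <= T by apply: sumr_ge0.
have -> : S = l`_i + T by rewrite /S (bigD1 i).
apply: le_trans (ler_wpM2l (l0 i) (HD _ _ (l0 i) T0)) _.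
rewrite powR_succ // mulrDr mulrCA lerD2l mulrCA -[leRHS]mulrA ler_wpM2l //.
have zp : 0 < z%:R :> R by rewrite ltr0n (leq_ltn_trans _ (ltn_ord i)).
have -> : T `^ s = z%:R `^ s * (T / z%:R) `^ s.
  by rewrite -powRM ?divr_ge0 // ?(ltW zp) // mulrCA mulfV ?gt_eqF // mulr1.
rewrite mulrCA ler_wpM2l ?powR_ge0 //.
have Tz : 0 <= T / z%:R by rewrite divr_ge0 ?(ltW zp).
apply: le_trans (ler_wpM2l (l0 i) (HC _ Tz)) _.
rewrite mulrDr [l`_i * C]mulrC lerD2r -mulr_sumr mulrCA -!mulrA ler_wpM2l ?(ltW e0) //.
rewrite [leRHS]mulrCA ler_wpM2l // [leRHS]mulrC jensen_powR ?ltrDr //.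
by apply: leq_trans (max_card _) _; rewrite card_ord.
Qed.

End powR_inequalities.

(** * Unit flows on a finite rooted tree *)

Section rooted_tree_flows.
Context {R : realType} {V : finType} (root : V) (par : V -> V) (h : V -> nat).
Context (adj : rel V).
Hypothesis h_eq0 : forall x, (h x == 0%N) = (x == root).
Hypothesis h_par : forall x, x != root -> h x = (h (par x)).+1.
Hypothesis adjE : forall x y,
  adj x y = ((y != root) && (par y == x)) || ((x != root) && (par x == y)).

Lemma h_root : h root = 0%N.
Proof. by apply/eqP; rewrite h_eq0. Qed.

(** The neighbours of a vertex are its children and its parent; comparing heights,
    no vertex is both. *)
Lemma sum_adjE (x : V) (f : V -> R) :
  \sum_(y | adj x y) f y =
  \sum_(y | (y != root) && (par y == x)) f y +
  (if x != root then f (par x) else 0).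
Proof.
transitivity (\sum_(y | (y != root) && (par y == x)) f y +
  \sum_(y | (x != root) && (par x == y)) f y); last first.
  congr (_ + _); case: ifPn => xr /=.
    by rewrite (eq_bigl (pred1 (par x))) ?big_pred1_eq // => y; rewrite eq_sym.
  by rewrite big_pred0.
rewrite (eq_bigl _ _ (adjE x)) (bigID (fun y => (y != root) && (par y == x))) /=.
congr (_ + _); apply: eq_bigl => y; first by rewrite orbK.
case: (boolP ((y != root) && (par y == x))) => [/andP[yr /eqP pyx]|_] /=;
  last by rewrite andbT.
rewrite ?andbF; apply/esym/negbTE/negP => /andP[xr /eqP pxy].
have := h_par yr; rewrite pyx (h_par xr) pxy => /eqP.
by rewrite -addn2 -{1}[h y]addn0 eqn_add2l.
Qed.

(** A sum over ordered adjacent pairs meets the edge above each vertex twice. *)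
Lemma sum_adj_edges (g : V -> V -> R) :
  (forall x y, adj x y -> g x y = g y x) ->
  2^-1 * (\sum_x \sum_(y | adj x y) g x y) =
  \sum_(y | y != root) g (par y) y.
Proof.
move=> gC; under eq_bigr do rewrite sum_adjE.
rewrite big_split /= -big_mkcond /=.
have -> : \sum_x \sum_(y | (y != root) && (par y == x)) g x y =
    \sum_(y | y != root) g (par y) y.
  rewrite [RHS](partition_big par xpredT) //=; apply: eq_bigr => x _.
  by apply: eq_bigr => y /andP[_ /eqP ->].
have -> : \sum_(x | x != root) g x (par x) = \sum_(y | y != root) g (par y) y.
  by apply: eq_bigr => x xr; apply: gC; rewrite adjE xr eqxx orbT.
lra.
Qed.

Lemma sum_by_height (n : nat) (f : V -> R) : (forall x, (h x <= n)%N) ->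
  \sum_(y | y != root) f y = \sum_(1 <= k < n.+1) \sum_(y | h y == k) f y.
Proof.
move=> hn.
rewrite (eq_bigl (fun y => (0 < h y)%N)); last by move=> y; rewrite lt0n h_eq0.
rewrite [RHS](eq_bigr (fun k => \sum_y if h y == k then f y else 0)); last first.
  by move=> k _; rewrite -big_mkcond.
rewrite exchange_big /= big_mkcond; apply: eq_bigr => y _.
rewrite -big_mkcond /=.
rewrite (eq_bigl (fun k => k == h y)); last by move=> k; rewrite eq_sym.
by rewrite big_nat1_eq ltnS hn andbT.
Qed.

Section unit_flows.
Variables (n : nat).
Hypothesis n_gt0 : (0 < n)%N.
Hypothesis h_le : forall x, (h x <= n)%N.

(** What enters level [k] from above leaves it downwards, by conservation; the
    induction starts with the unit of flow that leaves the root. *)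
Lemma unit_flow_level (theta : V -> V -> R) k :
  unit_flow adj [set root]%SET [set x | h x == n]%SET theta ->
  (1 <= k <= n)%N -> \sum_(y | h y == k) theta (par y) y = 1.
Proof.
move=> [thN thK th1]; elim: k => // -[_ _|k IH /= kn].
  rewrite -th1 big_set1.
  transitivity (\sum_(y | adj root y) theta root y).
    rewrite sum_adjE eqxx /= addr0; apply: eq_big => y.
      by case: (eqVneq y root) => [->|yr] /=; rewrite ?h_root // (h_par yr) eqSS h_eq0.
    case: (eqVneq y root) => [->|yr]; first by rewrite h_root.
    by rewrite (h_par yr) eqSS h_eq0 => /eqP ->.
  by apply: eq_bigl => y; rewrite !inE; case: eqVneq => //= ->; rewrite adjE eqxx.
rewrite -IH ?(ltnW kn)//.
rewrite (partition_big par (fun x => h x == k.+1)); last first.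
  move=> y hy; have yr : y != root by rewrite -h_eq0 (eqP hy).
  by rewrite (h_par yr) eqSS in hy.
apply: eq_bigr => x /eqP hx.
have xr : x != root by rewrite -h_eq0 hx.
have /thK : x \notin ([set root] :|: [set x | h x == n])%SET.
  by rewrite !inE negb_or xr hx ltn_eqF.
rewrite sum_adjE xr thN ?adjE ?xr ?eqxx// => /eqP; rewrite subr_eq0 => /eqP <-.
apply: eq_big => y.
  case: (eqVneq y root) => [->|yr] /=; first by rewrite h_root.
  rewrite (h_par yr) eqSS; case: (eqVneq (par y) x) => [->|]; last by rewrite andbF.
  by rewrite hx eqxx.
by move=> /andP[_ /eqP ->].
Qed.

(** A tree that carries a unit flow has at least one edge. *)
Lemma unit_flow_weight_gt0 (theta : V -> V -> R) (w : V -> R) :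
  unit_flow adj [set root]%SET [set x | h x == n]%SET theta ->
  (forall y, 0 < w y) -> 0 < \sum_(y | y != root) w y.
Proof.
move=> uth w0; rewrite lt_def sumr_ge0 ?andbT => [|y _]; last exact: ltW (w0 y).
apply/negP => /eqP A0.
have := unit_flow_level uth (_ : (1 <= 1 <= n)%N); rewrite n_gt0 => /(_ isT).
rewrite big1 => [/eqP|y /eqP hy]; first by rewrite eq_sym oner_eq0.
have := psumr_eq0P (fun y _ => ltW (w0 y)) A0 (_ : y != root).
by rewrite -h_eq0 hy => /(_ isT) /eqP; rewrite gt_eqF ?w0.
Qed.

Section energy.
Variables (res : V -> V -> R) (p : R).
Hypothesis p_gt1 : 1 < p.
Hypothesis resC : forall x y, adj x y -> res x y = res y x.
Hypothesis res_gt0 : forall x y, 0 < res x y.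
Notation s := (p - 1)^-1.
Notation q := (p / (p - 1)).

Lemma p_energy_edges (theta : V -> V -> R) :
  (forall x y, adj x y -> theta y x = - theta x y) ->
  p_energy adj res p theta =
  \sum_(y | y != root) res (par y) y `^ s * `|theta (par y) y| `^ q.
Proof.
move=> thN; rewrite /p_energy sum_adj_edges // => x y xy.
by rewrite (thN x y) // normrN resC.
Qed.

(** The easy half of the duality between flows and potentials, for a potential
    that drops by [delta k] across level [k]. The flow, weighted by these drops,
    sums to at least 1; Jensen's inequality for the weights
    [res^-1 * delta `^ p] bounds the energy from below. *)
Lemma p_energy_ge (theta : V -> V -> R) (delta : nat -> R) :
  unit_flow adj [set root]%SET [set x | h x == n]%SET theta ->
  (forall k, 0 < delta k) -> \sum_(1 <= k < n.+1) delta k = 1 ->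
  (\sum_(y | y != root) (res (par y) y)^-1 * delta (h y) `^ p)^-1 <=
  p_energy adj res p theta `^ (p - 1).
Proof.
move=> uth d0 d1; have [thN _ _] := uth; rewrite p_energy_edges //.
set A := \sum_(y | y != root) _; set B := \sum_(y | y != root) _.
pose w y := (res (par y) y)^-1 * delta (h y) `^ p.
have w0 y : 0 < w y by rewrite mulr_gt0 ?invr_gt0 ?powR_gt0.
have A0 : 0 < A := unit_flow_weight_gt0 uth w0.
have sumth : 1 <= \sum_(y | y != root) `|theta (par y) y| * delta (h y).
  rewrite (sum_by_height _ h_le) -d1 !big_nat; apply: ler_sum => k kn.
  rewrite -[leLHS]mul1r -(unit_flow_level uth kn) mulr_suml; apply: ler_sum => y /eqP ->.
  by rewrite ler_wpM2r ?ler_norm // ltW.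
have p10 : 0 < p - 1 by rewrite subr_gt0.
(* the tangent line inequality at [A * |theta| * res * delta `^ (1 - p)],
   weighted by [w] and summed over the edges *)
have AB : A <= A `^ q * B.
  rewrite /B mulr_sumr.
  apply: (@le_trans _ _ (\sum_(y | y != root)
    (q * A * (`|theta (par y) y| * delta (h y)) - (q - 1) * w y))).
    rewrite big_split /= sumrN -!mulr_sumr -/A.
    rewrite lerBrDr; apply: le_trans (_ : q * A * 1 <= _).
      by rewrite mulr1 mulrBl mul1r addrC subrK.
    by rewrite ler_wpM2l // mulr_ge0 ?ltW // divr_gt0 // (lt_trans ltr01).
  apply: ler_sum => y yr.
  set t := `|_|; have t0 : 0 <= t by exact: normr_ge0.
  set r := res _ _; have r0 : 0 < r by exact: res_gt0.
  rewrite /w -/r; set d := delta _; have dd0 : 0 < d by exact: d0.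
  have y0 : 0 <= A * t * r * d `^ (1 - p) by rewrite !mulr_ge0 ?powR_ge0 // ltW.
  have wy0 : 0 <= r^-1 * d `^ p by rewrite mulr_ge0 ?powR_ge0 // invr_ge0 ltW.
  have := ler_wpM2l wy0 (bernoulli_powR y0 (_ : 1 < q)).
  rewrite ltr_pdivlMr // mul1r ltrBlDr ltrDl ltr01 => /(_ isT).
  congr (_ <= _); last first.
    rewrite !powRM ?mulr_ge0 ?powR_ge0 ?(ltW A0) ?(ltW r0) // mulrACA.
    have <- : r^-1 * d `^ p * (r `^ q * d `^ (1 - p) `^ q) = r `^ s.
      rewrite -{1}[r]lnK // !powR_exp ?expR_gt0 // !expRK -expRN -!expRD.
      by congr expR; field; rewrite gt_eqF.
    by ring.
  have dE : r^-1 * d `^ p * (r * d `^ (1 - p)) = d.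
    rewrite mulrACA mulVf ?gt_eqF // mul1r -powRD; last by rewrite (gt_eqF dd0) implybT.
    by rewrite addrC subrK powRr1 // ltW.
  by rewrite -[X in t * X]dE; ring.
have AqE : A `^ q = A * A `^ s.
  rewrite -{2}[A](powRr1 (ltW A0)) -powRD ?(gt_eqF A0) ?implybT //.
  by congr (_ `^ _); field; rewrite gt_eqF.
have {AB} : 1 <= A `^ s * B by rewrite -(ler_pM2l A0) mulr1 mulrA -AqE.
move=> AB; have B0 : 0 <= B by apply: sumr_ge0 => y _; rewrite mulr_ge0 ?powR_ge0.
have := ge0_ler_powR (ltW p10) (_ : 1 \in Num.nneg) (_ : A `^ s * B \in Num.nneg) AB.
rewrite !nnegrE mulr_ge0 ?powR_ge0 // ler01 => /(_ isT isT).
rewrite powR1 powRM ?powR_ge0 // -powRrM mulVf ?gt_eqF // powRr1 ?(ltW A0) // => AB'.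
by rewrite -(ler_pM2l A0) mulfV ?gt_eqF.
Qed.

Lemma p_resistance_ge0 (A B : {set V}) : (0 <= p_resistance adj res p A B)%E.
Proof. by apply: le_ereal_inf_tmp => _ [theta _ <-]; rewrite lee_fin powR_ge0. Qed.

Lemma p_conductance_ge0 (A B : {set V}) : (0 <= p_conductance adj res p A B)%E.
Proof. by rewrite inve_ge0 p_resistance_ge0. Qed.

Lemma p_conductance_le (delta : nat -> R) :
  (forall k, 0 < delta k) -> \sum_(1 <= k < n.+1) delta k = 1 ->
  (p_conductance adj res p [set root]%SET [set x | h x == n]%SET <=
   (\sum_(y | y != root) (res (par y) y)^-1 * delta (h y) `^ p)%:E)%E.
Proof.
move=> d0 d1; set A := \sum_(y | y != root) _.
have A0 : 0 <= A.
  by apply: sumr_ge0 => y _; rewrite mulr_ge0 ?powR_ge0 // invr_ge0 ltW.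
rewrite inve_ple ?inE ?p_resistance_ge0 ?lee_fin //.
apply: le_ereal_inf_tmp => _ [theta uth <-].
rewrite inver gt_eqF ?lee_fin ?p_energy_ge //.
by apply: unit_flow_weight_gt0 uth _ => y; rewrite mulr_gt0 ?invr_gt0 ?powR_gt0.
Qed.

(** Trial flow: the edge above [y] carries [phi y / phi root]. *)
Lemma p_conductance_ge (phi : V -> R) :
  (forall x, 0 <= phi x) -> 0 < phi root ->
  (forall x, (h x < n)%N ->
    phi x = \sum_(y | (y != root) && (par y == x)) phi y) ->
  (((\sum_(y | y != root) res (par y) y `^ s * (phi y / phi root) `^ q)
     `^ (p - 1))^-1%:E <=
   p_conductance adj res p [set root]%SET [set x | h x == n]%SET)%E.
Proof.
move=> phi0 phir phiK; set B := \sum_(y | y != root) _.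
pose theta x y := if (y != root) && (par y == x) then phi y / phi root else
  if (x != root) && (par x == y) then - (phi x / phi root) else 0.
have thE y : y != root -> theta (par y) y = phi y / phi root.
  by move=> yr; rewrite /theta yr eqxx.
have nocycle x y : x != root -> par x = y -> y != root -> par y = x -> False.
  move=> xr xy yr yx; have := h_par yr; rewrite yx (h_par xr) xy => /eqP.
  by rewrite -addn2 -{1}[h y]addn0 eqn_add2l.
have thE' y : y != root -> theta y (par y) = - (phi y / phi root).
  move=> yr; rewrite /theta yr eqxx; case: andP => // -[pr /eqP py].
  by case: (nocycle y (par y)).
have thN x y : adj x y -> theta y x = - theta x y.
  by rewrite adjE => /orP[] /andP[xr /eqP <-]; rewrite thE // thE' // opprK.
have childE x : (h x < n)%N ->
    \sum_(y | (y != root) && (par y == x)) theta x y = phi x / phi root.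
  move=> hx; rewrite (phiK x hx) mulr_suml; apply: eq_bigr => y /andP[yr /eqP <-].
  exact: thE.
have uth : unit_flow adj [set root]%SET [set x | h x == n]%SET theta.
  split=> // [x|].
    rewrite !inE negb_or => /andP[xr hx]; rewrite sum_adjE xr thE' // childE ?subrr //.
    by rewrite ltn_neqAle hx h_le.
  rewrite big_set1 -(divff (lt0r_neq0 phir)).
  rewrite -childE ?h_root //; transitivity (\sum_(y | adj root y) theta root y).
    by apply: eq_bigl => y; rewrite !inE; case: eqVneq => //= ->; rewrite adjE eqxx.
  by rewrite sum_adjE eqxx addr0.
have BE : p_energy adj res p theta = B.
  rewrite p_energy_edges //; apply: eq_bigr => y yr; rewrite thE // ger0_norm //.
  by rewrite divr_ge0 // ltW.
have rB : (p_resistance adj res p [set root]%SET [set x | h x == n]%SET <=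
    (B `^ (p - 1))%:E)%E.
  by apply: ereal_inf_lbound; exists theta => //; rewrite BE.
case: (eqVneq (B `^ (p - 1)) 0) => [->|B0].
  by rewrite invr0 p_conductance_ge0.
rewrite (_ : _%:E = (B `^ (p - 1))%:E^-1)%E; last by rewrite inver (negbTE B0).
by rewrite lee_pV2 // ?inE ?p_resistance_ge0 // lee_fin powR_ge0.
Qed.

End energy.
End unit_flows.
End rooted_tree_flows.

(** * The graph of a Galton-Watson tree *)

Definition shift_tree (u : seq nat) (z : seq nat -> nat) : seq nat -> nat :=
  fun v => z (u ++ v).

Section gw_levels.
Implicit Types (z : seq nat -> nat) (v : seq nat).

Lemma size_mem_gw_level z k v : v \in gw_level z k -> size v = k.
Proof.
elim: k v => [|k IH] v /=; first by rewrite inE => /eqP ->.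
by move=> /allpairsPdep[u [i [/IH <- _ ->]]]; rewrite size_rcons.
Qed.

Lemma rcons_mem_gw_level z k v i :
  (rcons v i \in gw_level z k.+1) = (v \in gw_level z k) && (i < z v)%N.
Proof.
apply/allpairsPdep/andP => [[u [j [uk]]]|[vk iz]].
  by rewrite mem_iota /= => jz /rcons_inj[-> ->].
by exists v, i; rewrite mem_iota.
Qed.

Lemma gw_level_uniq z k : uniq (gw_level z k).
Proof.
elim: k => //= k IH; apply: allpairs_uniq_dep => // [v _|].
  exact: iota_uniq.
by move=> [u i] [v j] _ _ /= /rcons_inj[-> ->].
Qed.

Lemma mem_gw_tree z n v :
  (v \in gw_tree z n) = (size v <= n)%N && (v \in gw_level z (size v)).
Proof.
apply/flatten_mapP/andP => [[k]|[vn vl]]; last by exists (size v); rewrite ?mem_iota.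
by rewrite mem_iota ltnS => /= kn vk; rewrite (size_mem_gw_level vk).
Qed.

(** [gw_level] extends words at their end, whereas the branching property
    separates the subtrees of the children of the root. The operation need not
    commute, so that concatenation is covered and levels can be compared as
    lists. *)
Lemma big_gw_levelS (R : Type) (idx : R) (op : Monoid.law idx) z k
    (F : seq nat -> R) :
  \big[op/idx]_(v <- gw_level z k.+1) F v =
  \big[op/idx]_(i <- iota 0 (z [::]))
    \big[op/idx]_(v <- gw_level (shift_tree [:: i] z) k) F (i :: v).
Proof.
elim: k F => [|k IH] F.
  rewrite big_allpairs_dep big_seq1; apply: eq_bigr => i _; by rewrite big_seq1.
rewrite big_allpairs_dep IH; apply: eq_bigr => i _.
by rewrite big_allpairs_dep.
Qed.

Lemma size_gw_levelS z k : size (gw_level z k.+1) =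
  (\sum_(i <- iota 0 (z [::])) size (gw_level (shift_tree [:: i] z) k))%N.
Proof.
rewrite -sum1_size big_gw_levelS; apply: eq_bigr => i _; exact: sum1_size.
Qed.

End gw_levels.

Section gw_tree_graph.
Context {R : realType}.
Variables (z : seq nat -> nat) (n : nat).
Hypothesis n_gt0 : (0 < n)%N.
Let V : finType := seq_sub (gw_tree z n).
Let h (x : V) := size (val x).

Lemma root_mem_gw_tree : [::] \in gw_tree z n.
Proof. by rewrite mem_gw_tree. Qed.

Definition gw_root : V := SeqSub root_mem_gw_tree.

Definition gw_parent (x : V) : V := insubd gw_root (take (size (val x)).-1 (val x)).

Lemma gw_root_eq (x : V) : (x == gw_root) = (val x == [::]).
Proof. by []. Qed.

Lemma gw_vertexP (x : V) : x != gw_root ->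
  exists i, val x = rcons (val (gw_parent x)) i.
Proof.
rewrite gw_root_eq; have := valP x; rewrite /gw_parent.
case/lastP: (val x) => // v i vi _; exists i.
rewrite size_rcons /= -cats1 take_size_cat // cats1 insubdK //.
move: vi; rewrite !mem_gw_tree size_rcons rcons_mem_gw_level => /and3P[/ltnW -> ->].
by [].
Qed.

Lemma gw_height_parent (x : V) : x != gw_root -> h x = (h (gw_parent x)).+1.
Proof. by move=> /gw_vertexP[i]; rewrite /h => ->; rewrite size_rcons. Qed.

Lemma gw_parent_eq (x y : V) : 
  (y != gw_root) && (gw_parent y == x) = is_parent (val x) (val y).
Proof.
rewrite gw_root_eq /is_parent; case: eqVneq => //= yr.
have [|i yE] := @gw_vertexP y; first by rewrite gw_root_eq.
rewrite yE size_rcons /= -cats1 take_size_cat //.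
by rewrite eq_sym.
Qed.

Lemma gw_adjE (x y : V) : tree_adj (val x) (val y) =
  ((y != gw_root) && (gw_parent y == x)) || ((x != gw_root) && (gw_parent x == y)).
Proof. by rewrite !gw_parent_eq. Qed.

Lemma big_gw_tree (P : pred (seq nat)) (s : seq (seq nat)) (F : seq nat -> R) :
  uniq s -> (forall v, (v \in s) = (v \in gw_tree z n) && P v) ->
  \sum_(x : V | P (val x)) F (val x) = \sum_(v <- s) F v.
Proof.
move=> us sE.
rewrite -big_filter -(big_map val xpredT F); apply: perm_big.
apply: uniq_perm => //.
  by rewrite map_inj_uniq ?filter_uniq ?index_enum_uniq //; exact: val_inj.
move=> v; rewrite sE; apply/mapP/andP => [[x]|[vt Pv]].
  by rewrite mem_filter => /andP[Px _] ->; split => //; exact: valP.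
by exists (SeqSub vt) => //; rewrite mem_filter mem_index_enum andbT.
Qed.

Lemma big_gw_tree_level k (F : seq nat -> R) : (k <= n)%N ->
  \sum_(x : V | h x == k) F (val x) = \sum_(v <- gw_level z k) F v.
Proof.
move=> kn; apply: (big_gw_tree (P := fun v => size v == k)).
  exact: gw_level_uniq.
move=> v; rewrite mem_gw_tree; apply/idP/idP => [vk|/andP[/andP[_ +] /eqP <-//]].
by rewrite (size_mem_gw_level vk) kn vk eqxx.
Qed.

Lemma big_gw_tree_children (x : V) (F : seq nat -> R) : (h x < n)%N ->
  \sum_(y | (y != gw_root) && (gw_parent y == x)) F (val y) =
  \sum_(i <- iota 0 (z (val x))) F (rcons (val x) i).
Proof.
move=> xn; under eq_bigl do rewrite gw_parent_eq.
rewrite -(big_map (rcons (val x)) xpredT F).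
apply: (big_gw_tree (P := is_parent (val x))).
  by rewrite map_inj_uniq ?iota_uniq // => i j /rcons_inj[].
move=> v; have := valP x; rewrite !mem_gw_tree => /andP[_ xl].
apply/mapP/andP => [[i + ->]|[/andP[+ +] /andP[]]].
  rewrite mem_iota size_rcons xn rcons_mem_gw_level xl /= /is_parent => ->.
  by rewrite size_rcons -cats1 take_size_cat ?eqxx //; case: (val x).
case/lastP: v => // u i; rewrite size_rcons rcons_mem_gw_level /= => _ /andP[_ iu] _.
rewrite -cats1 take_size_cat // => /eqP ->; exists i; first by rewrite mem_iota.
by rewrite cats1.
Qed.

Section conductance.
Variables (p r : R).
Hypotheses (p_gt1 : 1 < p) (r_gt0 : 0 < r).
Notation s := (p - 1)^-1.
Notation q := (p / (p - 1)).

Let tree_resC (x y : V) : tree_adj (val x) (val y) ->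
  tree_res r (val x) (val y) = tree_res r (val y) (val x).
Proof. by rewrite /tree_res maxnC. Qed.

Let tree_res_gt0 (x y : V) : 0 < tree_res r (val x) (val y).
Proof. by rewrite invr_gt0 exprn_gt0. Qed.

Let tree_res_parent (x : V) : x != gw_root ->
  tree_res r (val (gw_parent x)) (val x) = r ^- h x.
Proof.
by move=> xr; rewrite /tree_res -!/(h _) (gw_height_parent xr) (maxn_idPr (leqnSn _)).
Qed.

Let h_le (x : V) : (h x <= n)%N.
Proof. by have := valP x; rewrite mem_gw_tree => /andP[]. Qed.

Let h_eq0 (x : V) : (h x == 0%N) = (x == gw_root).
Proof. by rewrite size_eq0. Qed.

Let rootE : [set x : V | val x == [::]]%SET = [set gw_root]%SET.
Proof. by apply/setP => x; rewrite !inE. Qed.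

Lemma tree_conductance_le (delta : nat -> R) :
  (forall k, 0 < delta k) -> \sum_(1 <= k < n.+1) delta k = 1 ->
  (tree_conductance p r z n <=
   (\sum_(1 <= k < n.+1)
      r ^+ k * delta k `^ p * (size (gw_level z k))%:R)%:E)%E.
Proof.
move=> d0 d1; rewrite /tree_conductance rootE.
have := p_conductance_le h_eq0 gw_height_parent gw_adjE n_gt0 h_le p_gt1
  tree_resC tree_res_gt0 d0 d1.
move/le_trans; apply; rewrite lee_fin (sum_by_height h_eq0 _ h_le) !big_nat.
apply: ler_sum => k /andP[k0 kn].
rewrite [leLHS](_ : _ = \sum_(x | h x == k) r ^+ k * delta k `^ p).
  rewrite (big_gw_tree_level (fun=> r ^+ k * delta k `^ p)) //.
  by rewrite big_const_seq count_predT iter_addr_0 mulr_natr.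
apply: eq_bigr => x /eqP hx.
by rewrite tree_res_parent -?h_eq0 hx -?lt0n // invrK.
Qed.

(** Trial flow: uniform on the leaves, so that the edge above [v] carries the
    proportion of leaves below [v]. *)
Lemma tree_conductance_ge : (0 < size (gw_level z n))%N ->
  (((\sum_(1 <= k < n.+1) (r ^- k) `^ s *
      \sum_(v <- gw_level z k)
        ((size (gw_level (shift_tree v z) (n - k)))%:R /
         (size (gw_level z n))%:R) `^ q) `^ (p - 1))^-1%:E <=
   tree_conductance p r z n)%E.
Proof.
move=> N0; rewrite /tree_conductance rootE.
pose phi (x : V) : R :=
  (size (gw_level (shift_tree (val x) z) (n - h x)))%:R.
have phi_root : phi gw_root = (size (gw_level z n))%:R by rewrite /phi subn0.
have phiK (x : V) : (h x < n)%N ->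
    phi x = \sum_(y | (y != gw_root) && (gw_parent y == x)) phi y.
  move=> xn.
  rewrite /phi (big_gw_tree_children
    (fun v => (size (gw_level (shift_tree v z) (n - size v)))%:R)) //.
  rewrite -(subnSK xn) size_gw_levelS natr_sum /shift_tree cats0.
  apply: eq_bigr => i _; rewrite size_rcons.
  by congr (size (gw_level _ _))%:R; apply/funext => w; rewrite -cats1 -catA.
have phir : 0 < phi gw_root by rewrite phi_root ltr0n.
have := p_conductance_ge h_eq0 gw_height_parent gw_adjE n_gt0 h_le p
  tree_resC (phi := phi) (fun=> ler0n _ _) phir phiK.
apply: le_trans; rewrite lee_fin (sum_by_height h_eq0 _ h_le) !big_nat phi_root.
rewrite le_eqVlt; apply/orP; left; apply/eqP; congr ((_ `^ _)^-1).
apply: eq_bigr => k /andP[k0 kn].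
rewrite mulr_sumr -(big_gw_tree_level (fun v => _ * (_ / _) `^ q)) //.
apply: eq_bigr => x /eqP hx.
by rewrite tree_res_parent -?h_eq0 hx -?lt0n // /phi hx.
Qed.

End conductance.
End gw_tree_graph.

(** * Integrals of functions on the natural numbers *)

Section nat_integrals.
Context {R : realType}.

Lemma measurable_fun_into_nat d (T : measurableType d) (f : T -> nat) :
  (forall k, measurable (f @^-1` [set k])) -> measurable_fun setT f.
Proof.
move=> mf _ A _; rewrite setTI.
have -> : f @^-1` A = \bigcup_(k in A) f @^-1` [set k].
  by apply/seteqP; split=> [x Ax|x [k Ak /= ->]] //; exists (f x).
by apply: bigcup_measurable.
Qed.

Lemma ge0_integral_nat (nu : {measure set nat -> \bar R}) (F : nat -> \bar R) :
  (forall k, 0 <= F k)%E ->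
  (\int[nu]_k F k = \sum_(k <oo) (F k * nu [set k]))%E.
Proof.
move=> F0; have -> : [set: nat] = \bigcup_k [set k].
  by apply/seteqP; split=> // x _; exists x.
rewrite ge0_integral_bigcup //; last first.
  apply/trivIsetP => i j _ _ ij; apply/seteqP; split=> // x [/= -> ijE].
  by move: ij; rewrite ijE eqxx.
apply: eq_eseriesr => k _; rewrite -integral_cst //.
by apply: eq_integral => x; rewrite inE /= => ->.
Qed.

Lemma nneseries_delta (F : nat -> \bar R) k : (forall k, 0 <= F k)%E ->
  (\sum_(j <oo) (F j * (k == j)%:R%:E))%E = F k.
Proof.
move=> F0; rewrite (@nneseriesD1 _ _ k xpredT) //=; last first.
  by move=> j _; rewrite mule_ge0.
rewrite eqxx mule1 eseries0 ?adde0 // => j _ /=.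
by rewrite eq_sym => /negbTE ->; rewrite mule0.
Qed.

End nat_integrals.

Section iterated_integral.
Context {R : realType}.

(** The integral over [k] independent points of law [nu]. *)
Fixpoint iter_integral (nu : set nat -> \bar R) (k : nat)
    (G : seq nat -> \bar R) : \bar R :=
  if k is k'.+1 then
    (\int[nu]_t iter_integral nu k' (fun l => G (t :: l)))%E
  else G [::].

Variable nu : probability nat R.
Implicit Types (G H : seq nat -> \bar R) (f : nat -> R).

Lemma integral_probability_cst (c : \bar R) : (\int[nu]_t c = c)%E.
Proof.
rewrite integral_cst // -[RHS]mule1; congr (_ * _)%E; exact: probability_setT.
Qed.

Lemma iter_integral_ge0 k G : (forall l, 0 <= G l)%E ->
  (0 <= iter_integral nu k G)%E.
Proof.
by elim: k G => [|k IH] G G0 //=; apply: integral_ge0 => t _; exact: IH.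
Qed.

Lemma le_iter_integral k G H : (forall l, 0 <= G l)%E ->
  (forall l, size l = k -> G l <= H l)%E ->
  (iter_integral nu k G <= iter_integral nu k H)%E.
Proof.
elim: k G H => [|k IH] G H G0 GH /=; first exact: GH.
apply: ge0_le_integral => // t _; first exact: iter_integral_ge0.
by apply: IH => // l lk; apply: GH; rewrite /= lk.
Qed.

Lemma iter_integralD k G H : (forall l, 0 <= G l)%E -> (forall l, 0 <= H l)%E ->
  iter_integral nu k (fun l => G l + H l)%E =
  (iter_integral nu k G + iter_integral nu k H)%E.
Proof.
elim: k G H => [|k IH] G H G0 H0 //=.
rewrite -ge0_integralD //; [|by move=> t _; exact: iter_integral_ge0..].
by apply: eq_integral => t _; rewrite IH.
Qed.

Lemma iter_integralZl k c G : (0 <= c)%E -> (forall l, 0 <= G l)%E ->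
  iter_integral nu k (fun l => c * G l)%E = (c * iter_integral nu k G)%E.
Proof.
move=> c0; elim: k G => [|k IH] G G0 //=.
rewrite -ge0_integralZl //; last by move=> t _; exact: iter_integral_ge0.
by apply: eq_integral => t _; rewrite IH.
Qed.

Lemma iter_integral_nneseries k (G : nat -> seq nat -> \bar R) :
  (forall j l, 0 <= G j l)%E ->
  iter_integral nu k (fun l => \sum_(j <oo) G j l)%E =
  (\sum_(j <oo) iter_integral nu k (G j))%E.
Proof.
elim: k G => [|k IH] G G0 //=.
rewrite -integral_nneseries //; last by move=> j t _; exact: iter_integral_ge0.
by apply: eq_integral => t _; rewrite IH.
Qed.

Lemma iter_integral_cst k c : iter_integral nu k (fun=> c) = c.
Proof.
by elim: k => //= k ->; rewrite integral_probability_cst.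
Qed.

Lemma iter_integral_point k (m : seq nat) :
  iter_integral nu k (fun l => (l == m)%:R%:E) =
  if k == size m then (\prod_(t <- m) nu [set t])%E else 0%E.
Proof.
elim: k m => [|k IH] [|t0 m] /=; rewrite ?big_nil //.
  by rewrite integral0_eq // => t _; rewrite iter_integral_cst.
under eq_integral => t _.
  rewrite (_ : (fun l => _) = (fun l => (t == t0)%:R%:E * (l == m)%:R%:E)%E); last first.
    by apply/funext => l; rewrite eqseq_cons -EFinM -natrM mulnb.
  rewrite iter_integralZl // IH muleC; over.
rewrite /= eqSS; case: ifP => _; last by rewrite integral0_eq // => t _; rewrite mul0e.
have ? : (0 <= \prod_(t <- m) nu [set t])%E by apply: prode_ge0.
rewrite ge0_integralZl // big_cons muleC; congr (_ * _)%E.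
rewrite -[in RHS](setIT [set t0]) -integral_indic //.
apply: eq_integral => t _; rewrite indicE; congr ((nat_of_bool _)%:R%:E).
by apply/idP/idP => [/eqP ->|/set_mem /= ->]; [exact: mem_set|exact: eqxx].
Qed.

Lemma iter_integral_sum k f : (forall t, 0 <= f t) ->
  iter_integral nu k (fun l => (\sum_(t <- l) f t)%:E) =
  (k%:R%:E * \int[nu]_t (f t)%:E)%E.
Proof.
move=> f0; elim: k => [|k IH] /=; first by rewrite big_nil mul0e.
under eq_integral => t _.
  rewrite (_ : (fun l => _) = (fun l => (f t)%:E + (\sum_(t <- l) f t)%:E)%E); last first.
    by apply/funext => l; rewrite big_cons EFinD.
  rewrite iter_integralD ?iter_integral_cst ?IH; [over| |].
    by move=> l; rewrite lee_fin.
  by move=> l; rewrite lee_fin sumr_ge0.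
have I0 : (0 <= \int[nu]_t (f t)%:E)%E by apply: integral_ge0 => t _; rewrite lee_fin.
rewrite /= ge0_integralD //.
- rewrite integral_probability_cst.
  by rewrite -natr1 EFinD ge0_muleDl ?lee_fin // mul1e addeC.
- by move=> t _; rewrite lee_fin.
- by move=> t _; rewrite mule_ge0 // lee_fin.
Qed.

Lemma iter_integral_prod k f e : (forall t, 0 <= f t) ->
  (\int[nu]_t (f t)%:E = e%:E)%E ->
  iter_integral nu k (fun l => (\prod_(t <- l) f t)%:E) = (e ^+ k)%:E.
Proof.
move=> f0 fe; have e0 : 0 <= e.
  by rewrite -lee_fin -fe; apply: integral_ge0 => t _; rewrite lee_fin.
elim: k => [|k IH] /=; first by rewrite big_nil.
under eq_integral => t _.
  rewrite (_ : (fun l => _) = (fun l => (f t)%:E * (\prod_(t <- l) f t)%:E)%E); last first.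
    by apply/funext => l; rewrite big_cons EFinM.
  rewrite iter_integralZl ?lee_fin // ?IH; last by move=> l; rewrite lee_fin prodr_ge0.
  rewrite muleC; over.
rewrite ge0_integralZl ?lee_fin ?exprn_ge0 //.
  by rewrite fe -EFinM -exprSr.
by move=> t _; rewrite lee_fin.
Qed.

(** The terms of the cross sum are products of two independent factors, and there
    are at most [k ^ 2] of them. *)
Lemma iter_integral_cross_le k f q (a b : R) : (forall t, 0 <= f t) ->
  (\int[nu]_t (f t)%:E = a%:E)%E -> (\int[nu]_t (f t `^ q)%:E <= b%:E)%E ->
  (iter_integral nu k (fun l => (cross_sum q [seq f t | t <- l])%:E) <=
   (k%:R ^+ 2 * (a * b))%:E)%E.
Proof.
move=> f0 fa fb.
have a0 : 0 <= a.
  by rewrite -lee_fin -fa; apply: integral_ge0 => t _; rewrite lee_fin.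
have b0 : 0 <= b.
  rewrite -lee_fin; apply: le_trans fb.
  by apply: integral_ge0 => t _; rewrite lee_fin powR_ge0.
have c0 l : 0 <= cross_sum q [seq f t | t <- l].
  by apply: cross_sum_ge0 => _ /mapP[t _ ->].
elim: k => [|k IH] /=; first by rewrite expr0n /= mul0r.
have qsum0 l : 0 <= \sum_(t <- l) f t `^ q by apply: sumr_ge0 => t _; exact: powR_ge0.
have sum0 l : 0 <= \sum_(t <- l) f t by apply: sumr_ge0.
pose fq t := f t `^ q; have fq0 t : 0 <= fq t by exact: powR_ge0.
have -> : (\int[nu]_t iter_integral nu k
    (fun l => (cross_sum q [seq f t' | t' <- t :: l])%:E) =
  \int[nu]_t (k%:R%:E * \int[nu]_t' (fq t')%:E * (f t)%:E +
    k%:R%:E * a%:E * (fq t)%:E +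
    iter_integral nu k (fun l => (cross_sum q [seq f t | t <- l])%:E)))%E.
  apply: eq_integral => t _ /=.
  rewrite (_ : (fun l => _) = (fun l => (f t)%:E * (\sum_(t <- l) fq t)%:E +
     (fq t)%:E * (\sum_(t <- l) f t)%:E + (cross_sum q [seq f t | t <- l])%:E)%E); last first.
    by apply/funext => l; rewrite -!EFinM -!EFinD !big_map.
  rewrite !iter_integralD ?iter_integralZl ?iter_integral_sum ?lee_fin // ?fa;
    try by move=> l; rewrite ?adde_ge0 ?mule_ge0 ?lee_fin.
  by congr (_ + _ + _)%E; rewrite muleC.
have iq0 : (0 <= \int[nu]_t (fq t)%:E)%E by apply: integral_ge0 => t _; rewrite lee_fin.
rewrite !ge0_integralD //;
  try by move=> t _; rewrite ?adde_ge0 ?mule_ge0 ?lee_fin ?iter_integral_ge0.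
rewrite !ge0_integralZl //; try by move=> t _; rewrite ?lee_fin.
  rewrite fa integral_probability_cst.
  have H : (k%:R%:E * \int[nu]_t (fq t)%:E * a%:E <= (k%:R * b * a)%:E)%E.
    by rewrite !EFinM lee_wpmul2r ?lee_fin // lee_wpmul2l ?lee_fin.
  have H' : (k%:R%:E * a%:E * \int[nu]_t (fq t)%:E <= (k%:R * a * b)%:E)%E.
    by rewrite !EFinM lee_wpmul2l ?mule_ge0 ?lee_fin.
  apply: le_trans (leeD (leeD H H') IH) _.
  rewrite -!EFinD lee_fin -natr1.
  have : 0 <= a * b by rewrite mulr_ge0.
  by lra.
all: by rewrite ?mule_ge0 ?lee_fin.
Qed.

End iterated_integral.

Section nat_expectation.
Context {R : realType}.
Variable nu : probability nat R.
Implicit Types f g : nat -> R.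

Lemma le_nat_integral f g : (forall t, 0 <= f t) -> (forall t, f t <= g t) ->
  (\int[nu]_t (f t)%:E <= \int[nu]_t (g t)%:E)%E.
Proof.
by move=> f0 fg; apply: ge0_le_integral => // t _; rewrite lee_fin // (le_trans (f0 t)).
Qed.

Lemma nat_integralD f g : (forall t, 0 <= f t) -> (forall t, 0 <= g t) ->
  (\int[nu]_t (f t + g t)%:E = \int[nu]_t (f t)%:E + \int[nu]_t (g t)%:E)%E.
Proof.
move=> f0 g0; rewrite -ge0_integralD //; last by move=> t _; rewrite lee_fin.
by move=> t _; rewrite lee_fin.
Qed.

Lemma nat_integralZl c f : 0 <= c -> (forall t, 0 <= f t) ->
  (\int[nu]_t (c * f t)%:E = c%:E * \int[nu]_t (f t)%:E)%E.
Proof.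
move=> c0 f0; rewrite -ge0_integralZl // ?lee_fin // => t _.
by rewrite lee_fin.
Qed.

Lemma nat_integral_pred (A : pred nat) :
  (\int[nu]_t ((A t)%:R : R)%:E = nu [set t | A t])%E.
Proof.
rewrite -[X in nu X]setIT -integral_indic //; apply: eq_integral => t _.
rewrite indicE; congr ((nat_of_bool _)%:R%:E).
by apply/idP/idP => [At|/set_mem //]; exact: mem_set.
Qed.

Lemma nat_markov f (e c : R) : (forall t, 0 <= f t) -> 0 < c ->
  (\int[nu]_t (f t)%:E <= e%:E)%E -> (nu [set t | (c < f t)%R] <= (e / c)%:E)%E.
Proof.
move=> f0 c0 fe; rewrite -nat_integral_pred.
apply: (@le_trans _ _ (\int[nu]_t (c^-1 * f t)%:E)%E).
  apply: le_nat_integral => t; first exact: ler0n.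
  case: ltP => [cf|_]; last by rewrite mulr_ge0 // invr_ge0 ltW.
  by rewrite -(ler_pM2l c0) mulr1 mulrA mulfV ?gt_eqF // mul1r ltW.
rewrite nat_integralZl ?invr_ge0 ?(ltW c0) // mulrC EFinM.
by rewrite lee_wpmul2l // lee_fin invr_ge0 ltW.
Qed.

End nat_expectation.

Lemma nat_integral_sum {R : realType} (nu : probability nat R) (I : Type)
    (r : seq I) (f : I -> nat -> R) : (forall i t, 0 <= f i t) ->
  (\int[nu]_t (\sum_(i <- r) f i t)%:E =
   \sum_(i <- r) \int[nu]_t (f i t)%:E)%E.
Proof.
move=> f0; rewrite -ge0_integral_sum //.
- by apply: eq_integral => t _; rewrite sumEFin.
- by move=> i t _; rewrite lee_fin.
Qed.

(** All sets of natural numbers are measurable, so whatever is a function of a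
    natural number-valued random variable is measurable. *)
Lemma measurable_set_determined {d : measure_display} {T : measurableType d}
    (X : T -> nat) (E : set T) :
  measurable_fun setT X -> (forall w w', X w = X w' -> E w -> E w') ->
  measurable E.
Proof.
move=> mX EX; have -> : E = X @^-1` (X @` E).
  by apply/seteqP; split=> w /= => [Ew|[w' Ew' /EX]]; [exists w|exact].
by rewrite -[X in measurable X]setTI; exact: mX.
Qed.

Lemma measurable_fun_determined {d d' : measure_display} {T : measurableType d}
    {U : sigmaRingType d'} (X : T -> nat) (f : T -> U) :
  measurable_fun setT X -> (forall w w', X w = X w' -> f w = f w') ->
  measurable_fun setT f.
Proof.
move=> mX fX _ B _; rewrite setTI.
by apply: measurable_set_determined mX _ => w w' /fX /= ->.
Qed.

(** * Trees of bounded height as natural numbers *)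

(** The numbers of children of all vertices of height less than [n], packed in one
    natural number: the list of the codes of the subtrees of the root is encoded
    again as a number. *)
Fixpoint tree_code (n : nat) (z : seq nat -> nat) : nat :=
  if n is k.+1 then
    CodeSeq.code [seq tree_code k (shift_tree [:: i] z) | i <- iota 0 (z [::])]
  else 0%N.

Lemma shift_tree0 z : shift_tree [::] z = z.
Proof. by apply/funext. Qed.

Lemma shift_tree_rcons u i z :
  shift_tree [:: i] (shift_tree u z) = shift_tree (rcons u i) z.
Proof. by apply/funext => v; rewrite /shift_tree -cats1 -catA. Qed.

Lemma tree_codeS_eq n z t : (tree_code n.+1 z == t) =
  (z [::] == size (CodeSeq.decode t)) &&
  all (fun i => tree_code n (shift_tree [:: i] z) == nth 0%N (CodeSeq.decode t) i)
    (iota 0 (size (CodeSeq.decode t))).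
Proof.
rewrite /= -(can_eq CodeSeq.decodeK) CodeSeq.codeK.
move: (CodeSeq.decode t) => l; apply/eqP/andP => [<-|[/eqP zl /allP al]].
  rewrite size_map size_iota eqxx; split=> //; apply/allP => i iz.
  by rewrite (nth_map 0%N) ?size_iota ?nth_iota //; move: iz; rewrite mem_iota.
apply: (@eq_from_nth _ 0%N); rewrite size_map size_iota // => i iz.
rewrite (nth_map 0%N) ?size_iota // nth_iota // add0n.
by apply/eqP/al; rewrite mem_iota -zl.
Qed.

(** [S] and [L] are finite partial functions given by their graphs. When [L] is
    made of vertices of one height and [S] of lower ones, these events are stable under
    revealing one more generation (see [tree_eventS]). *)
Definition tree_event n (S L : seq (seq nat * nat)) (z : seq nat -> nat) : bool :=
  all (fun x => z x.1 == x.2) S &&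
  all (fun x => tree_code n (shift_tree x.1 z) == x.2) L.

Definition subtrees (L : seq (seq nat * nat)) : seq (seq nat * nat) :=
  [seq (rcons x.1 i, nth 0%N (CodeSeq.decode x.2) i) |
    x <- L, i <- iota 0 (size (CodeSeq.decode x.2))].

Lemma tree_eventS n S L z : tree_event n.+1 S L z =
  tree_event n (S ++ [seq (x.1, size (CodeSeq.decode x.2)) | x <- L])
    (subtrees L) z.
Proof.
rewrite /tree_event all_cat -andbA; congr (_ && _).
elim: L => // -[u t] L IH.
have -> : subtrees ((u, t) :: L) = [seq (rcons u i, nth 0%N (CodeSeq.decode t) i) |
   i <- iota 0 (size (CodeSeq.decode t))] ++ subtrees L by [].
rewrite all_cat [all _ (_ :: L)]/= IH tree_codeS_eq /= !all_map.
rewrite {1}/shift_tree cats0 -!andbA; congr (_ && _).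
rewrite [RHS]andbCA; congr (_ && _); apply: eq_all => i /=.
by rewrite shift_tree_rcons.
Qed.

Section code_functionals.
Context {R : realType}.
Implicit Types (f g : nat -> R) (t : nat).

Fixpoint gen_sum (k : nat) f t : R :=
  if k is k'.+1 then \sum_(t' <- CodeSeq.decode t) gen_sum k' f t' else f t.

Fixpoint gen_prod (k : nat) f t : R :=
  if k is k'.+1 then \prod_(t' <- CodeSeq.decode t) gen_prod k' f t' else f t.

(** On codes of trees, [gen_sum k f] sums the values of [f] on the subtrees that
    start at generation [k]. *)
Lemma gen_sum_tree_code k j f z :
  gen_sum k f (tree_code (k + j) z) =
  \sum_(v <- gw_level z k) f (tree_code j (shift_tree v z)).
Proof.
elim: k z => [|k IH] z; first by rewrite big_seq1 shift_tree0.
rewrite addSn [LHS]/= CodeSeq.codeK big_map big_gw_levelS; apply: eq_bigr => i _.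
by rewrite IH; apply: eq_bigr => v _.
Qed.

Lemma gen_sum_ge0 k f t : (forall t, 0 <= f t) -> 0 <= gen_sum k f t.
Proof. by move=> f0; elim: k t => //= k IH t; apply: sumr_ge0. Qed.

Lemma gen_prod_ge0 k f t : (forall t, 0 <= f t) -> 0 <= gen_prod k f t.
Proof. by move=> f0; elim: k t => //= k IH t; apply: prodr_ge0. Qed.

Lemma gen_sumZ k c f t : gen_sum k (fun t' => c * f t') t = c * gen_sum k f t.
Proof.
by elim: k t => //= k IH t; rewrite mulr_sumr; apply: eq_bigr => t' _.
Qed.

Lemma gen_sumA k j f t : gen_sum (k + j) f t = gen_sum k (gen_sum j f) t.
Proof. by elim: k t => //= k IH t; apply: eq_bigr => t' _. Qed.

(** If a sum of nonnegative terms is less than [c], so is each of its terms. *)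
Lemma gen_sum_lt_gen_prod k f c t : (forall t, 0 <= f t) -> gen_sum k f t < c ->
  gen_prod k (fun t' => (f t' < c)%R%:R) t = 1.
Proof.
move=> f0; elim: k t => [|k IH] t /=; first by move=> ->.
move=> Sc; rewrite big_seq big1 // => t' t'in; apply: IH; apply: le_lt_trans Sc.
rewrite (big_rem t' t'in) /= lerDl; apply: sumr_ge0 => t'' _; exact: gen_sum_ge0.
Qed.

End code_functionals.

Section tree_code_determines.

Lemma tree_code_inj n z z' : tree_code n.+1 z = tree_code n.+1 z' ->
  z [::] = z' [::] /\ forall i, (i < z [::])%N ->
    tree_code n (shift_tree [:: i] z) = tree_code n (shift_tree [:: i] z').
Proof.
move/(can_inj CodeSeq.codeK) => E.
have zz' : z [::] = z' [::] by have := congr1 size E; rewrite !size_map !size_iota.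
split=> // i iz; move: E; rewrite -zz' => /eq_in_map; apply.
by rewrite mem_iota.
Qed.

Lemma gw_level_tree_code n z z' k : tree_code n z = tree_code n z' -> (k <= n)%N ->
  gw_level z k = gw_level z' k.
Proof.
have idE (s : seq (seq nat)) : \big[cat/[::]]_(v <- s) [:: v] = s.
  by elim: s => [|v s IH]; rewrite ?big_nil // big_cons IH.
elim: n k z z' => [|n IH] [|k] z z' //.
move=> /tree_code_inj[zz' E] kn; rewrite -[LHS]idE -[RHS]idE !big_gw_levelS -zz'.
rewrite big_seq [RHS]big_seq; apply: eq_bigr => i; rewrite mem_iota => /= iz.
by rewrite (IH _ _ _ (E i iz)).
Qed.

Lemma tree_conductance_code {R : realType} (p r : R) n z z' :
  tree_code n z = tree_code n z' ->
  tree_conductance p r z n = tree_conductance p r z' n.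
Proof.
move=> E; rewrite /tree_conductance.
have -> : gw_tree z n = gw_tree z' n.
  rewrite /gw_tree; congr flatten; apply/eq_in_map => k.
  by rewrite mem_iota ltnS => /= kn; exact: gw_level_tree_code kn.
by [].
Qed.

End tree_code_determines.

(** * The law of a coded tree and the branching property *)

Lemma uniq_map_inj_in (T1 T2 : eqType) (f : T1 -> T2) (s : seq T1) :
  uniq [seq f x | x <- s] -> {in s &, injective f}.
Proof.
elim: s => //= a s IH /andP[fa us] x y.
rewrite !inE => /predU1P[->|xs] /predU1P[->|ys] // fxy; last exact: IH.
- by rewrite fxy map_f in fa.
- by rewrite -fxy map_f in fa.
Qed.

Section code_law.
Context {R : realType}.

Fixpoint code_law (mu : set nat -> \bar R) (n t : nat) : \bar R :=
  if n is k.+1 then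
    (mu [set size (CodeSeq.decode t)] *
     \prod_(t' <- CodeSeq.decode t) code_law mu k t')%E
  else (t == 0%N)%:R%:E.

Context {d : measure_display} {Omega : measurableType d}.
Variables (P : probability Omega R) (Z : seq nat -> {RV P >-> nat}).
Variable mu : probability nat R.

Lemma measurable_tree_code n u k :
  measurable [set w | tree_code n (shift_tree u (fun v => Z v w)) = k].
Proof.
elim: n u k => [|n IH] u k.
  have [->|k0] := eqVneq k 0%N.
    by rewrite (_ : [set _ | _] = setT) //; apply/seteqP.
  rewrite (_ : [set _ | _] = set0) //; apply/seteqP; split=> // w /= /esym/eqP.
  by rewrite (negbTE k0).
pose l := CodeSeq.decode k.
rewrite (_ : [set _ | _] = (Z u @^-1` [set size l]) `&`
  \bigcap_(i in [set i | (i < size l)%N])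
   [set w | tree_code n (shift_tree (rcons u i) (fun v => Z v w)) = nth 0%N l i]).
  apply: measurableI; first by rewrite -[X in measurable X]setTI; exact: measurable_funP.
  by apply: bigcap_measurableType => // i _; exact: IH.
apply/seteqP; split => w.
  move=> /eqP; rewrite tree_codeS_eq {1}/shift_tree cats0 => /andP[/eqP zu /allP al].
  split=> // i /= il; apply/eqP; rewrite -shift_tree_rcons; apply: al.
  by rewrite mem_iota.
move=> [zu al]; apply/eqP; rewrite tree_codeS_eq {1}/shift_tree cats0; apply/andP; split.
  exact/eqP.
apply/allP => i; rewrite mem_iota => /= il; rewrite shift_tree_rcons; apply/eqP.
exact: al.
Qed.

Hypothesis HZ : gw_offspring mu Z.

Lemma offspring_points (S : seq (seq nat * nat)) : uniq (unzip1 S) ->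
  P [set w | all (fun x => Z x.1 w == x.2) S] = (\prod_(x <- S) mu [set x.2])%E.
Proof.
case: HZ => Zmu Zind uS.
(* independence requires a set for every word, hence a lookup in [S] *)
pose f v := nth 0%N (unzip2 S) (index v (unzip1 S)).
have fE x : x \in S -> f x.1 = x.2.
  move=> xS; have iS := xS; rewrite -index_mem in iS.
  rewrite /f; have -> : index x.1 (unzip1 S) = index x S.
    rewrite -{1}(nth_index x xS) /unzip1 -(nth_map x (fst x) fst) //.
    by rewrite index_uniq ?size_map.
  by rewrite (nth_map x) // nth_index.
have := Zind (unzip1 S) (fun v => [set f v]) uS.
rewrite big_map (_ : \bigcap_(_ in _) _ =
    [set w | all (fun x => Z x.1 w == x.2) S]); last first.
  apply/seteqP; split=> w /=.
    move=> H; apply/allP => x xS; rewrite -(fE x xS); apply/eqP.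
    by apply: (H x.1); rewrite /= map_f.
  by move=> /allP H _ /mapP[x xS ->] /=; rewrite fE //; exact/eqP/H.
move=> ->; apply: eq_big_seq => x xS; rewrite fE //; exact: Zmu.
Qed.

(** Revealing the roots of the subtrees in [L] moves them to [S], by
    [tree_eventS]; for [n = 0] nothing but independence of the numbers of children
    is left. The heights ensure that [S] and [L] stay disjoint. *)
Lemma tree_event_prob n h S L :
  uniq (unzip1 S) -> uniq (unzip1 L) ->
  {in S, forall x, size x.1 < h}%N -> {in L, forall x, size x.1 = h} ->
  P [set w | tree_event n S L (fun v => Z v w)] =
  (\prod_(x <- S) mu [set x.2] * \prod_(x <- L) code_law mu n x.2)%E.
Proof.
elim: n h S L => [|n IH] h S L uS uL Sh Lh.
  rewrite /tree_event /=; have [L0|L0] := boolP (all (fun x => 0 == x.2)%N L).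
    under eq_set do rewrite andbT; rewrite offspring_points //.
    suff -> : (\prod_(x <- L) (x.2 == 0%N)%:R%:E = 1 :> \bar R)%E by rewrite mule1.
    rewrite big_seq; apply: big1 => x xL.
    by rewrite eq_sym (allP L0 x xL).
  rewrite (_ : [set _ | _] = set0) ?measure0; last first.
    by apply/seteqP; split=> // w /=; rewrite andbF.
  have [x xL x0] := allPn L0.
  by rewrite (big_rem x xL) /= eq_sym (negbTE x0) mul0e mule0.
under eq_set do rewrite tree_eventS.
rewrite (IH h.+1).
- rewrite big_cat big_map /= -muleA; congr (_ * _)%E.
  rewrite /subtrees big_allpairs_dep /= -big_split /=; apply: eq_bigr => x _; congr (_ * _)%E.
  by rewrite [RHS](big_nth 0%N) /index_iota subn0.
- rewrite /unzip1 map_cat cat_uniq uS -map_comp uL andbT /=.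
  apply/hasPn => _ /mapP[x xL ->] /=; apply/mapP => -[y yS xy].
  by have := Sh y yS; rewrite -xy (Lh x xL) ltnn.
- rewrite /unzip1 /subtrees map_allpairs /=.
  apply: allpairs_uniq_dep => [|x _|]; [exact: map_uniq uL|exact: iota_uniq|].
  move=> [x i] [y j] /allpairsPdep[x' [i' [xL _ [-> ->]]]].
  move=> /allpairsPdep[y' [j' [yL _ [-> ->]]]] /= /rcons_inj[xy ->].
  by rewrite (uniq_map_inj_in uL xL yL xy).
- move=> x; rewrite mem_cat => /orP[/Sh /ltnW //|/mapP[y yL ->] /=].
  by rewrite Lh.
- by move=> x /allpairsPdep[y [i [yL _ ->]]]; rewrite size_rcons Lh.
Qed.

Lemma tree_code_law n t :
  P [set w | tree_code n (fun v => Z v w) = t] = code_law mu n t.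
Proof.
have := @tree_event_prob n 0 [::] [:: ([::], t)].
rewrite big_nil big_seq1 mul1e => <- //; last by move=> x; rewrite inE => /eqP ->.
congr (P _); apply/seteqP; split=> w; rewrite /tree_event /= andbT shift_tree0; by move/eqP.
Qed.

Definition tree_rv n (w : Omega) : nat := tree_code n (fun v => Z v w).

Lemma measurable_tree_rv n : measurable_fun setT (tree_rv n).
Proof.
apply: measurable_fun_into_nat => k; have := measurable_tree_code n [::] k.
by rewrite /preimage /tree_rv /=; under eq_set do rewrite shift_tree0.
Qed.

HB.instance Definition _ n :=
  isMeasurableFun.Build _ _ _ _ (tree_rv n) (measurable_tree_rv n).

Definition tree_law n : probability nat R := distribution P (tree_rv n : {RV P >-> nat}).

Lemma tree_law_point n t : tree_law n [set t] = code_law mu n t.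
Proof. exact: tree_code_law. Qed.

Lemma integral_tree_law n (F : nat -> \bar R) : (forall t, 0 <= F t)%E ->
  (\int[tree_law n]_t F t = \int[P]_w F (tree_rv n w))%E.
Proof. by move=> F0; rewrite ge0_integral_distribution. Qed.

(** The branching property. Both sides are countably additive in [F], and they
    agree on the indicator of a point, where each is a product over the vertices
    of the encoded tree. *)
Lemma integral_tree_lawS n (F : nat -> \bar R) : (forall t, 0 <= F t)%E ->
  (\int[tree_law n.+1]_t F t =
   \int[mu]_k iter_integral (tree_law n) k (fun l => F (CodeSeq.code l)))%E.
Proof.
move=> F0; rewrite ge0_integral_nat //.
have FE l : F (CodeSeq.code l) = (\sum_(j <oo) F j * (l == CodeSeq.decode j)%:R%:E)%E.
  rewrite -[LHS]nneseries_delta //; apply: eq_eseriesr => j _.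
  by rewrite -(can_eq CodeSeq.decodeK) CodeSeq.codeK.
under [RHS]eq_integral => k _.
  rewrite (_ : (fun l => _) =
      (fun l => \sum_(j <oo) F j * (l == CodeSeq.decode j)%:R%:E)%E); last first.
    exact/funext.
  rewrite iter_integral_nneseries; last by move=> j l; rewrite mule_ge0.
  over.
rewrite integral_nneseries //; last first.
  by move=> j k _; apply: iter_integral_ge0 => l; rewrite mule_ge0.
apply: eq_eseriesr => j _.
under eq_integral => k _.
  rewrite iter_integralZl // iter_integral_point.
  over.
rewrite ge0_integralZl //; last by move=> k _; case: ifP => // _; exact: prode_ge0.
congr (_ * _)%E; apply: (eq_trans (tree_law_point n.+1 j)) => /=.
have -> : (\prod_(t' <- CodeSeq.decode j) code_law mu n t' =
    \prod_(t <- CodeSeq.decode j) tree_law n [set t])%E.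
  by apply: eq_bigr => t _; exact/esym/tree_law_point.
set c := (\prod_(t <- _) _)%E.
have c0 : (0 <= c)%E by exact: prode_ge0.
rewrite muleC -[X in mu X]setIT -integral_indic // -ge0_integralZl //.
apply: eq_integral => k _; rewrite indicE; case: eqVneq => [->|kj].
  by rewrite mem_set ?mule1.
by rewrite memNset ?mule0 //; exact/eqP.
Qed.

End code_law.

(** * Moments and lower tail of the normalized population *)

Section galton_watson.
Context {R : realType}.
Variables (mu : probability nat R) (m : R).
Hypotheses (mu0 : mu [set 0%N] = 0%E) (mu1 : (mu [set 1%N] < 1)%E).
Hypothesis (mE : gw_mean mu = m%:E).

Definition prob_one := fine (mu [set 1%N]).

Lemma prob_oneE : mu [set 1%N] = prob_one%:E.
Proof. by rewrite /prob_one fineK // fin_num_measure. Qed.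

Lemma prob_one_ge0 : 0 <= prob_one.
Proof. by rewrite -lee_fin -prob_oneE. Qed.

Lemma prob_one_lt1 : prob_one < 1.
Proof. by rewrite -lte_fin -prob_oneE. Qed.

(** Integrate [2 <= k + (k == 1) + 2 * (k == 0)]. *)
Lemma mean_gt1 : 1 < m.
Proof.
have : (\int[mu]_k 2%:E <=
    \int[mu]_k ((k%:R : R) + ((k == 1%N)%:R + 2 * (k == 0%N)%:R))%:E)%E.
  apply: le_nat_integral => // -[|[|k]] /=;
    rewrite ?mulr1n ?mulr0n ?mulr1 ?mulr0 ?addr0 ?add0r //.
  by rewrite ler_nat.
rewrite integral_probability_cst nat_integralD // nat_integralD //.
rewrite nat_integralZl // !nat_integral_pred -/(gw_mean mu) mE.
rewrite (_ : [set k | k == 0%N] = [set 0%N]); last by apply/seteqP; split=> k /eqP.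
rewrite (_ : [set k | k == 1%N] = [set 1%N]); last by apply/seteqP; split=> k /eqP.
rewrite mu0 prob_oneE mule0 adde0 -EFinD lee_fin => H.
by have := prob_one_lt1; lra.
Qed.

(** For [k >= 2] one has [x ^+ k <= x ^+ 2], and [k = 0] has probability 0. *)
Lemma offspring_gf_le (x : R) : 0 <= x <= 1 ->
  (\int[mu]_k (x ^+ k)%:E <= ((prob_one + (1 - prob_one) * x) * x)%:E)%E.
Proof.
move=> /andP[x0 x1].
have : (\int[mu]_k (x ^+ k + x ^+ 2 * (k == 1%N)%:R)%:E <=
    \int[mu]_k ((k == 0%N)%:R + (x * (k == 1%N)%:R + x ^+ 2))%:E)%E.
  apply: le_nat_integral => k; first by rewrite addr_ge0 ?mulr_ge0 ?exprn_ge0.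
  case: k => [|[|k]] /=; rewrite ?mulr1n ?mulr0n ?mulr1 ?mulr0 ?addr0 ?add0r ?expr0 ?expr1 //.
    by rewrite lerDl exprn_ge0.
  by rewrite -addn2 exprD ler_piMl ?exprn_ge0 // exprn_ile1.
rewrite nat_integralD;
  [|by move=> k; rewrite exprn_ge0|by move=> k; rewrite mulr_ge0 ?exprn_ge0].
rewrite nat_integralZl ?exprn_ge0 // nat_integralD //; last first.
  by move=> k; rewrite addr_ge0 ?mulr_ge0 ?exprn_ge0.
rewrite nat_integralD; [|by move=> k; rewrite mulr_ge0|by move=> k; rewrite exprn_ge0].
rewrite nat_integralZl // !nat_integral_pred integral_probability_cst.
rewrite (_ : [set k | k == 0%N] = [set 0%N]); last by apply/seteqP; split=> k /eqP.
rewrite (_ : [set k | k == 1%N] = [set 1%N]); last by apply/seteqP; split=> k /eqP.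
rewrite mu0 prob_oneE add0e -leeBrDr // => /le_trans; apply.
by rewrite -!(EFinM, EFinN, EFinD) lee_fin; nra.
Qed.

Section law.
Context {d : measure_display} {Omega : measurableType d}.
Variables (P : probability Omega R) (Z : seq nat -> {RV P >-> nat}).
Hypothesis HZ : gw_offspring mu Z.
Local Notation law := (tree_law Z).

(** The many-to-one formula: each generation contributes a factor [m]. *)
Lemma integral_gen_sum k j (f : nat -> R) : (forall t, 0 <= f t) ->
  (\int[law (k + j)]_t (gen_sum k f t)%:E =
   (m ^+ k)%:E * \int[law j]_t (f t)%:E)%E.
Proof.
move=> f0; elim: k => [|k IH]; first by rewrite mul1e.
rewrite addSn (integral_tree_lawS HZ); last first.
  by move=> t; rewrite lee_fin gen_sum_ge0.
under eq_integral => l _.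
  rewrite (_ : (fun l => _) = (fun l => (\sum_(t <- l) gen_sum k f t)%:E)); last first.
    by apply/funext => l'; rewrite /= CodeSeq.codeK.
  rewrite iter_integral_sum; last by move=> t; exact: gen_sum_ge0.
  rewrite muleC; over.
rewrite ge0_integralZl //; last first.
  by apply: integral_ge0 => t _; rewrite lee_fin gen_sum_ge0.
by rewrite IH -/(gw_mean mu) mE muleC muleA -EFinM -exprS.
Qed.

(** The mean of [gen_prod k f] is the [k]-th iterate of the generating function of
    [mu] at the mean of [f]; near 0 this function is a contraction. *)
Lemma integral_gen_prod_le k j (f : nat -> R) x : (forall t, 0 <= f t <= 1) ->
  0 <= x <= 1 -> (\int[law j]_t (f t)%:E <= x%:E)%E ->
  (\int[law (k + j)]_t (gen_prod k f t)%:E <=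
   ((prob_one + (1 - prob_one) * x) ^+ k * x)%:E)%E.
Proof.
move=> f01 x01 fx; have /andP[x0 x1] := x01.
have f0 t : 0 <= f t by have /andP[] := f01 t.
set lam := prob_one + _.
have lam0 : 0 <= lam.
  by rewrite addr_ge0 ?prob_one_ge0 ?mulr_ge0 // subr_ge0 ltW ?prob_one_lt1.
have lam1 : lam <= 1 by have := prob_one_lt1; have := prob_one_ge0; rewrite /lam; nra.
elim: k => [|k IH]; first by rewrite mul1r.
rewrite addSn (integral_tree_lawS HZ); last first.
  by move=> t; rewrite lee_fin gen_prod_ge0.
set I := (\int[law (k + j)]_t _)%E in IH.
have I0 : (0 <= I)%E by apply: integral_ge0 => t _; rewrite lee_fin gen_prod_ge0.
have IE : I = (fine I)%:E.
  by rewrite fineK // ge0_fin_numE // (le_lt_trans IH) // ltry.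
move: IH; rewrite IE; set e := fine I => ele.
have e0 : 0 <= e by rewrite -lee_fin -IE.
have ex : e <= x.
  by rewrite lee_fin in ele; rewrite (le_trans ele) // ler_piMl // exprn_ile1.
under eq_integral => l _.
  rewrite (_ : (fun l => _) = (fun l => (\prod_(t <- l) gen_prod k f t)%:E)); last first.
    by apply/funext => l'; rewrite /= CodeSeq.codeK.
  rewrite (iter_integral_prod _ _ IE); last by move=> t; exact: gen_prod_ge0.
  over.
apply: (le_trans (offspring_gf_le _)); first by rewrite e0 (le_trans ex).
rewrite lee_fin exprS -mulrA ler_pM //.
- by rewrite addr_ge0 ?prob_one_ge0 ?mulr_ge0 // subr_ge0 ltW ?prob_one_lt1.
- by rewrite lerD2l ler_wpM2l // subr_ge0 ltW ?prob_one_lt1.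
Qed.

End law.
End galton_watson.

Section moments.
Context {R : realType}.
Variables (mu : probability nat R) (m : R).
Hypotheses (mu0 : mu [set 0%N] = 0%E) (mu1 : (mu [set 1%N] < 1)%E).
Hypothesis (mE : gw_mean mu = m%:E).

Definition population (n t : nat) : R := gen_sum n (fun=> 1) t.

Definition norm_population (n t : nat) : R := population n t / m ^+ n.

Let m_gt1 : 1 < m := mean_gt1 mu0 mu1 mE.
Let m_gt0 : 0 < m := lt_trans ltr01 m_gt1.

Lemma population_ge0 n t : 0 <= population n t.
Proof. by apply: gen_sum_ge0 => _; exact: ler01. Qed.

Lemma norm_population_ge0 n t : 0 <= norm_population n t.
Proof. by rewrite divr_ge0 ?population_ge0 // exprn_ge0 // ltW. Qed.

Lemma norm_populationS n l : norm_population n.+1 (CodeSeq.code l) =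
  m^-1 * \sum_(x <- [seq norm_population n t | t <- l]) x.
Proof.
rewrite big_map /norm_population /population /= CodeSeq.codeK -mulr_suml.
by rewrite exprS invfM mulrCA.
Qed.

Lemma integral_population {d : measure_display} {Omega : measurableType d}
    (P : probability Omega R) (Z : seq nat -> {RV P >-> nat}) n :
  gw_offspring mu Z ->
  (\int[tree_law Z n]_t (population n t)%:E = (m ^+ n)%:E)%E.
Proof.
move=> HZ; have := integral_gen_sum mE HZ n 0 (f := fun=> 1) (fun=> ler01).
by rewrite addn0 integral_probability_cst mule1.
Qed.

Lemma integral_norm_population {d : measure_display} {Omega : measurableType d}
    (P : probability Omega R) (Z : seq nat -> {RV P >-> nat}) n :
  gw_offspring mu Z ->
  (\int[tree_law Z n]_t (norm_population n t)%:E = 1)%E.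
Proof.
move=> HZ; under eq_integral do rewrite /norm_population mulrC.
rewrite nat_integralZl ?invr_ge0 ?exprn_ge0 ?(ltW m_gt0) //; last exact: population_ge0.
by rewrite integral_population // -EFinM mulVf // expf_neq0 // gt_eqF.
Qed.

(** With [A = m `^ (s / 2)] the diagonal terms of [powR_sum_le] contribute
    [m `^ - (s / 2) < 1] times the previous moment. Then [eps] is taken so small
    that the off-diagonal terms use up at most half of the gap to 1, and [K] is
    such that the resulting affine recursion preserves the bound [K]. Since [K]
    only involves [mu] and [s], it can be chosen before the probability space. *)
Lemma moment_bound (s : R) : 0 < s ->
  (\int[mu]_k ((k%:R : R) `^ (s + 1))%:E < +oo)%E ->
  exists K : R, 0 < K /\
    forall (d : measure_display) (Omega : measurableType d)
      (P : probability Omega R) (Z : seq nat -> {RV P >-> nat}) (n : nat),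
      gw_offspring mu Z ->
      (\int[tree_law Z n]_t (norm_population n t `^ (s + 1))%:E <= K%:E)%E.
Proof.
move=> s0; set I := (\int[mu]_k _)%E => I_lty.
have I0 : (0 <= I)%E by apply: integral_ge0 => k _; rewrite lee_fin powR_ge0.
have IE : I = (fine I)%:E by rewrite fineK // ge0_fin_numE.
set M := fine I in IE; have M0 : 0 <= M by rewrite -lee_fin -IE.
pose A := m `^ (s / 2); pose rho := m `^ (- (s / 2)).
have s20 : 0 < s / 2 by rewrite divr_gt0.
have A1 : 1 < A.
  have := gt0_ltr_powR s20 (_ : 1 \in Num.nneg) (_ : m \in Num.nneg) m_gt1.
  by rewrite powR1; apply; rewrite nnegrE // ltW.
have rho1 : rho < 1 by rewrite /rho powRN invf_lt1 // powR_gt0.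
have rho0 : 0 <= rho by exact: powR_ge0.
have [D [D0 HD]] := powR_sum_le s0 A1.
pose eps := (1 - rho) / 2 / (D * M + 1).
have DM0 : 0 <= D * M by rewrite mulr_ge0.
have e0 : 0 < eps by rewrite !divr_gt0 ?subr_gt0 // ltr_wpDl.
have [C [C0 HC]] := HD _ e0.
pose G := m^-1 `^ (s + 1); have G0 : 0 <= G by exact: powR_ge0.
have G1 : G <= 1.
  have mV1 : m^-1 <= 1 by rewrite invf_le1 ?(ltW m_gt1).
  have := ler_powRl (addr_ge0 (ltW s0) ler01) (_ : 0 <= m^-1) mV1.
  by rewrite powR1; apply; rewrite invr_ge0 ltW.
have GAm : G * A * m = rho.
  have -> : G * A * m = G * A * expR (ln m) by rewrite lnK.
  rewrite /G /A /rho !powR_exp ?invr_gt0 // lnV // -!expRD.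
  by congr expR; field.
pose C0' := D * M * C; pose r := (1 + rho) / 2.
have r1 : r < 1 by rewrite /r; lra.
have r0 : 0 <= r by rewrite /r; lra.
pose K := 1 + C0' / (1 - r).
have C0'0 : 0 <= C0' by rewrite mulr_ge0.
have K1 : 1 <= K by rewrite lerDl divr_ge0 // subr_ge0 ltW.
have K0 : 0 < K by exact: lt_le_trans K1.
(* [K] exceeds the fixed point of [u |-> r * u + C0'], and exceeds the initial
   moment 1 *)
have rK : r * K + C0' <= K.
  have : K * (1 - r) = 1 - r + C0'.
    by rewrite /K mulrDl mul1r divfK // subr_eq0 gt_eqF.
  by lra.
exists K; split=> // d Omega P Z n HZ; elim: n => [|n IH].
  under eq_integral do rewrite /norm_population /population /= expr0 divr1 powR1.
  by rewrite integral_probability_cst lee_fin.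
rewrite (integral_tree_lawS HZ); last by move=> t; rewrite lee_fin powR_ge0.
set W := norm_population n in IH *.
have W0 t : 0 <= W t by exact: norm_population_ge0.
pose B (k : nat) := G * D * k%:R `^ s.
have B0 k : 0 <= B k by rewrite !mulr_ge0 ?powR_ge0.
have step k : (iter_integral (tree_law Z n) k
    (fun l => (norm_population n.+1 (CodeSeq.code l) `^ (s + 1))%:E) <=
    ((G * A * K) * k%:R + G * D * (eps * K + C) * k%:R `^ (s + 1))%:E)%E.
  apply: (@le_trans _ _ (iter_integral (tree_law Z n) k (fun l =>
     (G * A)%:E * (\sum_(t <- l) W t `^ (s + 1))%:E +
     ((B k * (eps / k%:R))%:E * (cross_sum (s + 1) [seq W t | t <- l])%:E +
     (B k * C)%:E * (\sum_(t <- l) W t)%:E))%E)).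
    apply: le_iter_integral => l; first by rewrite lee_fin powR_ge0.
    move=> lk; rewrite -!EFinM -!EFinD lee_fin norm_populationS powRM; last 2 first.
      by rewrite invr_ge0 ltW.
      by rewrite big_map sumr_ge0.
    have := HC [seq W t | t <- l] (_ : forall x, x \in [seq W t | t <- l] -> 0 <= x).
    rewrite size_map lk; case/(_ _)/Wrap.
      by move=> _ /mapP[t _ ->].
    move/(ler_wpM2l G0)/le_trans; apply.
    by rewrite !big_map /B le_eqVlt; apply/orP; left; apply/eqP; ring.
  have S0 l : 0 <= \sum_(t <- l) W t by apply: sumr_ge0.
  have Sq0 l : 0 <= \sum_(t <- l) W t `^ (s + 1) by apply: sumr_ge0 => t _; exact: powR_ge0.
  have X0 l : 0 <= cross_sum (s + 1) [seq W t | t <- l].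
    by apply: cross_sum_ge0 => _ /mapP[t _ ->].
  have GA0 : 0 <= G * A by rewrite mulr_ge0 // powR_ge0.
  have Be0 : 0 <= B k * (eps / k%:R) by rewrite mulr_ge0 // divr_ge0 // ltW.
  have BC0 : 0 <= B k * C by rewrite mulr_ge0.
  rewrite !iter_integralD; try by move=> l; rewrite ?adde_ge0 ?mule_ge0 ?lee_fin.
  rewrite !iter_integralZl ?lee_fin //.
  rewrite !iter_integral_sum //; last by move=> t; exact: powR_ge0.
  have EW : (\int[tree_law Z n]_t (W t)%:E = 1)%E := integral_norm_population n HZ.
  rewrite EW mule1.
  have HX := iter_integral_cross_le k W0 EW IH.
  have H1 : (k%:R%:E * \int[tree_law Z n]_t (W t `^ (s + 1))%:E <= (k%:R * K)%:E)%E.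
    by rewrite EFinM lee_wpmul2l ?lee_fin.
  apply: (le_trans (leeD (lee_wpmul2l _ H1) (leeD (lee_wpmul2l _ HX) (lexx _)))).
  - by rewrite lee_fin.
  - by rewrite lee_fin.
  rewrite -!EFinM -!EFinD lee_fin powR_succ // mul1r.
  have -> : B k * (eps / k%:R) * (k%:R ^+ 2 * K) = B k * eps * K * k%:R.
    have [->|k0] := eqVneq k 0%N; first by rewrite invr0 !mulr0 mul0r.
    by field; rewrite pnatr_eq0.
  by rewrite /B le_eqVlt; apply/orP; left; apply/eqP; ring.
apply: (@le_trans _ _ (\int[mu]_k ((G * A * K) * k%:R +
    G * D * (eps * K + C) * k%:R `^ (s + 1))%:E)%E).
  apply: ge0_le_integral => // k _.
  by apply: iter_integral_ge0 => l; rewrite lee_fin powR_ge0.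
have c10 : 0 <= G * A * K by rewrite !mulr_ge0 ?powR_ge0 // ltW.
have c20 : 0 <= G * D * (eps * K + C).
  by rewrite !mulr_ge0 // addr_ge0 // mulr_ge0 // ltW.
rewrite nat_integralD;
  [|by move=> k; rewrite mulr_ge0|by move=> k; rewrite mulr_ge0 ?powR_ge0].
rewrite nat_integralZl // nat_integralZl //.
rewrite -/(gw_mean mu) mE -/I IE -!EFinM -EFinD lee_fin.
apply: le_trans rK.
have -> : G * A * K * m = rho * K by rewrite -GAm; ring.
have -> : G * D * (eps * K + C) * M = G * (D * M) * eps * K + G * C0' by rewrite /C0'; ring.
have H1 : G * C0' <= C0' by rewrite ler_piMl.
have H2 : G * (D * M) * eps <= (1 - rho) / 2.
  apply: (@le_trans _ _ ((D * M + 1) * eps)).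
    rewrite ler_wpM2r ?(ltW e0) //; apply: (@le_trans _ _ (D * M)); last by rewrite lerDl.
    by rewrite ler_piMl.
  by rewrite /eps mulrC divfK // gt_eqF // ltr_wpDl.
have : G * (D * M) * eps * K <= (1 - rho) / 2 * K by rewrite ler_wpM2r // ltW.
by rewrite /r; lra.
Qed.

End moments.

Section lower_tail.
Context {R : realType}.
Variables (mu : probability nat R) (m : R).
Hypotheses (mu0 : mu [set 0%N] = 0%E) (mu1 : (mu [set 1%N] < 1)%E).
Hypothesis (mE : gw_mean mu = m%:E).
Let m_gt1 : 1 < m := mean_gt1 mu0 mu1 mE.
Let m_gt0 : 0 < m := lt_trans ltr01 m_gt1.
Local Notation W := (norm_population m).

Lemma norm_population_gen_sum k j t :
  W (k + j) t = m ^- k * gen_sum k (W j) t.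
Proof.
have -> : gen_sum k (W j) t = m ^- j * gen_sum k (population j) t.
  by rewrite -gen_sumZ; congr (gen_sum _ _ _); apply/funext => t'; rewrite mulrC.
by rewrite /norm_population /population gen_sumA exprD invfM mulrA mulrC.
Qed.

Variables (s K : R).
Hypotheses (s_gt0 : 0 < s) (K_gt0 : 0 < K).

Section law.
Context {d : measure_display} {Omega : measurableType d}.
Variables (P : probability Omega R) (Z : seq nat -> {RV P >-> nat}).
Hypothesis HZ : gw_offspring mu Z.
Local Notation law := (tree_law Z).
Hypothesis HK : forall n, (\int[law n]_t (W n t `^ (s + 1))%:E <= K%:E)%E.

(** An estimate of Paley-Zygmund type. The part of the unit mean of [W n] that
    comes from values below [1/2] is at most [1/2], and, by the moment bound,
    capping [W n] at a large constant loses at most [1/4]. *)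
Lemma half_norm_population : exists x : R, 0 <= x < 1 /\
  forall n, (\int[law n]_t ((W n t < 2^-1)%R%:R : R)%:E <= x%:E)%E.
Proof.
have e0 : 0 < (4 * K)^-1 by rewrite invr_gt0 mulr_gt0.
have [C [C0 HC]] := le_eps_powR_succ s_gt0 e0.
have C10 : 0 < C + 1 by rewrite ltr_wpDl.
exists (1 - (4 * (C + 1))^-1); split.
  rewrite subr_ge0 invf_le1 ?mulr_gt0 // ltrBlDr ltrDl invr_gt0 mulr_gt0 //.
  by rewrite andbT; lra.
move=> n; set f := fun t => ((W n t < 2^-1)%R%:R : R).
have f0 t : 0 <= f t by exact: ler0n.
have : (\int[law n]_t (W n t + (C + 1) * f t)%:E <=
   \int[law n]_t (2^-1 + (C + 1) + (4 * K)^-1 * W n t `^ (s + 1))%:E)%E.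
  have W0 t : 0 <= W n t by exact: (norm_population_ge0 mu0 mu1 mE).
  apply: le_nat_integral => t; first by rewrite addr_ge0 ?W0 // mulr_ge0 // ltW.
  have := HC _ (W0 t); have H : 0 <= (4 * K)^-1 * W n t `^ (s + 1).
    by rewrite mulr_ge0 ?powR_ge0 // ltW.
  by rewrite /f; case: ltP => /= H1 H2; lra.
have W0 t : 0 <= W n t by exact: (norm_population_ge0 mu0 mu1 mE).
rewrite nat_integralD; [|exact: W0|by move=> t; rewrite mulr_ge0 ?f0 ?(ltW C10)].
rewrite (integral_norm_population mu0 mu1 mE n HZ) nat_integralZl ?(ltW C10) //.
rewrite nat_integralD; last 2 first.
  by move=> t; rewrite addr_ge0 // ?(ltW C10).
  by move=> t; rewrite mulr_ge0 ?powR_ge0 ?(ltW e0).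
rewrite integral_probability_cst nat_integralZl ?(ltW e0) //;
  last by move=> t; exact: powR_ge0.
set I := (\int[law n]_t (f t)%:E)%E.
have I0 : (0 <= I)%E by apply: integral_ge0 => t _; rewrite lee_fin.
have HI : ((4 * K)^-1%:E * \int[law n]_t (W n t `^ (s + 1))%:E <= (4^-1)%:E)%E.
  apply: le_trans (lee_wpmul2l _ (HK n)) _; first by rewrite lee_fin ltW.
  by rewrite -EFinM lee_fin invfM -mulrA mulVf ?gt_eqF // mulr1.
move=> /le_trans/(_ (leeD (lexx _) HI)).
have I1 : (I <= 1)%E.
  rewrite -[leRHS](integral_probability_cst (law n)); apply: le_nat_integral => // t.
  by rewrite /f; case: (_ < _).
have IE : I = (fine I)%:E by rewrite fineK // ge0_fin_numE // (le_lt_trans I1) // ltry.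
rewrite IE -EFinM -!EFinD !lee_fin => H.
rewrite lerBrDl -lerBrDr -(ler_pM2l C10) mulrBr mulr1.
have -> : (C + 1) * (4 * (C + 1))^-1 = 4^-1 by rewrite invfM mulrCA mulfV ?gt_eqF // mulr1.
by lra.
Qed.

(** After [k] generations there are many vertices, and [W (k + j)] is at least
    [m ^- k] times any one of their normalized populations; the probability that
    all of these are below [1/2] is at most [lam ^+ k]. *)
Lemma small_norm_population (eps : R) : 0 < eps ->
  exists delta : R, 0 < delta /\
    forall n, (law n [set t | (W n t < delta)%R] <= eps%:E)%E.
Proof.
move=> e0; have [x [/andP[x0 x1] Hx]] := half_norm_population.
set lam := prob_one mu + (1 - prob_one mu) * x.
have lam01 : 0 <= lam < 1.
  have := prob_one_ge0 mu; have := prob_one_lt1 mu1; rewrite /lam => H1 H2.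
  by apply/andP; split; nra.
have [k lamk] : exists k, lam ^+ k < eps.
  have /cvgrPdist_lt/(_ eps e0)[k _ Hk] : (lam ^+ k) @[k --> \oo] --> (0 : R).
    by apply: cvg_expr; rewrite ger0_norm; case/andP: lam01.
  exists k; have := Hk k (leqnn k); rewrite /= sub0r normrN; apply: le_lt_trans.
  exact: ler_norm.
exists (m ^- k / 2); split; first by rewrite divr_gt0 // invr_gt0 exprn_gt0.
move=> n; rewrite -nat_integral_pred.
have W0 j t : 0 <= W j t by exact: (norm_population_ge0 mu0 mu1 mE).
have [kn|nk] := leqP k n.
  rewrite -(subnKC kn); set j := (n - k)%N.
  pose f t := ((W j t < 2^-1)%R%:R : R).
  have f01 t : 0 <= f t <= 1 by rewrite /f; case: (_ < _); rewrite /= ?lexx ?ler01.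
  apply: (@le_trans _ _ (\int[law (k + j)]_t (gen_prod k f t)%:E)%E).
    apply: le_nat_integral => t; first exact: ler0n.
    case: ltP => [|_] /=; last by apply: gen_prod_ge0 => t'; case/andP: (f01 t').
    rewrite norm_population_gen_sum ltr_pM2l ?invr_gt0 ?exprn_gt0 // => H.
    by rewrite gen_sum_lt_gen_prod.
  apply: le_trans (integral_gen_prod_le mu0 mu1 HZ k f01 _ (Hx j)) _.
    by rewrite x0 ltW.
  rewrite lee_fin -/lam; apply: le_trans (ltW lamk).
  by case/andP: lam01 => l0 l1; rewrite ler_piMr ?exprn_ge0 // ltW.
(* for [n < k] the event [W n t < m ^- k / 2] forces extinction, which has
   probability 0: apply the bound on products with the zero function *)
apply: (@le_trans _ _ (\int[law n]_t (gen_prod n (fun=> 0) t)%:E)%E).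
  apply: le_nat_integral => t; first exact: ler0n.
  case: ltP => [H|_] /=; last by apply: gen_prod_ge0.
  have : gen_sum n (fun=> (1 : R)) t < 1.
    move: H; rewrite /norm_population ltr_pdivrMr ?exprn_gt0 // => /lt_trans; apply.
    rewrite mulrAC ltr_pdivrMr // mul1r; apply: (@le_lt_trans _ _ 1); last by rewrite ltr1n.
    by rewrite mulrC ler_pdivrMr ?exprn_gt0 // mul1r ler_weXn2l ?(ltW m_gt1) ?(ltnW nk).
  by move/(gen_sum_lt_gen_prod (fun=> ler01)); rewrite ltxx mulr0n => ->.
have := integral_gen_prod_le mu0 mu1 HZ n (j := 0) (f := fun=> 0) (x := 0).
rewrite addn0 mulr0 lexx ler01 => /(_ (fun=> isT) isT).
rewrite integral_probability_cst => /(_ (lexx _))/le_trans; apply.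
by rewrite lee_fin ltW.
Qed.

End law.
End lower_tail.

(** * Energies and conductance of a coded tree *)

Section conductance_of_code.
Context {R : realType}.
Variables (m p r : R).
Hypotheses (m_gt0 : 0 < m) (p_gt1 : 1 < p) (r_gt0 : 0 < r).
Local Notation W := (norm_population m).
Local Notation s := (p - 1)^-1.
Let p10 : 0 < p - 1. Proof. by rewrite subr_gt0. Qed.
Let s_gt0 : 0 < s. Proof. by rewrite invr_gt0. Qed.
Let qE : p / (p - 1) = s + 1.
Proof. by field; rewrite gt_eqF. Qed.

Lemma gen_sum_level z k n (f : nat -> R) : (k <= n)%N ->
  gen_sum k f (tree_code n z) =
  \sum_(v <- gw_level z k) f (tree_code (n - k) (shift_tree v z)).
Proof. by move=> kn; rewrite -{1}(subnKC kn) gen_sum_tree_code. Qed.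

Lemma level_size z k n : (k <= n)%N ->
  gen_sum k (fun=> 1) (tree_code n z) = (size (gw_level z k))%:R :> R.
Proof.
move=> kn; rewrite gen_sum_level //.
by rewrite big_const_seq count_predT iter_addr_0.
Qed.

(** The energy of the flow that is uniform on the leaves, multiplied by
    [W n t `^ (s + 1)]: this removes the random denominator and leaves a
    combination of generation sums. *)
Definition flow_energy (n t : nat) : R :=
  \sum_(1 <= k < n.+1) (r ^- k) `^ s * (m ^- k) `^ (s + 1) *
    gen_sum k (fun t' => W (n - k) t' `^ (s + 1)) t.

Lemma flow_energy_ge0 n t : 0 <= flow_energy n t.
Proof.
apply: sumr_ge0 => k _; rewrite !mulr_ge0 ?powR_ge0 //.
by apply: gen_sum_ge0 => t'; exact: powR_ge0.
Qed.

Lemma flow_energy_gt0 n t : (0 < n)%N -> (0 : R) < population n t -> 0 < flow_energy n t.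
Proof.
move=> n0 N0; rewrite /flow_energy big_nat_recr //=.
apply: ltr_wpDl; first by apply: sumr_ge0 => k _; rewrite !mulr_ge0 ?powR_ge0 //;
  apply: gen_sum_ge0 => t'; exact: powR_ge0.
rewrite mulr_gt0 ?mulr_gt0 ?powR_gt0 ?invr_gt0 ?exprn_gt0 // subnn.
have -> // : (fun t' => W 0 t' `^ (s + 1)) = (fun=> 1).
by apply/funext => t'; rewrite /norm_population /population /= expr0 divr1 powR1.
Qed.

Lemma tree_conductance_ge_code z n : (0 < n)%N ->
  ((W n (tree_code n z) `^ p * (flow_energy n (tree_code n z) `^ (p - 1))^-1)%:E
   <= tree_conductance p r z n)%E.
Proof.
move=> n0; set t := tree_code n z.
have NE : population n t = (size (gw_level z n))%:R :> R by exact: level_size (leqnn n).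
have [N0|N0] := posnP (size (gw_level z n)).
  rewrite {1}/norm_population NE N0 mul0r powR0 ?mul0r;
    last by rewrite gt_eqF // (lt_trans ltr01).
  exact: p_conductance_ge0.
apply: le_trans (tree_conductance_ge n0 p r N0).
rewrite lee_fin le_eqVlt; apply/orP; left; apply/eqP.
have W0 : 0 < W n t by rewrite divr_gt0 ?NE ?ltr0n // exprn_gt0.
have mn0 k : m ^+ k != 0 by rewrite expf_neq0 // gt_eqF.
rewrite [X in _ = X^-1](_ : _ =
    (flow_energy n t / W n t `^ (s + 1)) `^ (p - 1)); last first.
  congr (_ `^ _); rewrite /flow_energy mulr_suml !big_nat; apply: eq_bigr => k /andP[k0 kn].
  rewrite /t gen_sum_level // -!mulrA; congr (_ * _).
  rewrite mulr_suml mulr_sumr; apply: eq_bigr => v _.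
  have -> : (size (gw_level (shift_tree v z) (n - k)))%:R =
      W (n - k) (tree_code (n - k) (shift_tree v z)) * m ^+ (n - k).
    by rewrite divfK // /population level_size.
  have -> : (size (gw_level z n))%:R = W n t * m ^+ n by rewrite divfK.
  have Wv0 t' : 0 <= W (n - k) t'.
    by rewrite divr_ge0 ?exprn_ge0 ?(ltW m_gt0) //; apply: gen_sum_ge0.
  rewrite qE [RHS]mulrA -powRM ?invr_ge0 ?exprn_ge0 ?(ltW m_gt0) //.
  have -> : (W n t `^ (s + 1))^-1 = (W n t)^-1 `^ (s + 1).
    by rewrite powR_invl // ltW.
  have mk0 : 0 <= m ^- k by rewrite invr_ge0 exprn_ge0 // ltW.
  rewrite -powRM; [|exact: mulr_ge0 mk0 (Wv0 _)|by rewrite invr_ge0 ltW].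
  congr (_ `^ _).
  have -> : m ^+ n = m ^+ k * m ^+ (n - k) by rewrite -exprD subnKC.
  by field; rewrite !mn0 gt_eqF.
rewrite powRM ?flow_energy_ge0 ?invr_ge0 ?powR_ge0 //.
rewrite invfM mulrC; congr (_ * _).
rewrite powR_invl ?powR_ge0 // invrK -powRrM.
by congr (_ `^ _); field; rewrite gt_eqF.
Qed.

Definition cut_energy (delta : nat -> R) (n t : nat) : R :=
  \sum_(1 <= k < n.+1) r ^+ k * delta k `^ p * gen_sum k (fun=> 1) t.

Lemma cut_energy_ge0 delta n t : 0 <= cut_energy delta n t.
Proof.
apply: sumr_ge0 => k _; rewrite !mulr_ge0 ?powR_ge0 ?exprn_ge0 ?(ltW r_gt0) //.
exact: gen_sum_ge0.
Qed.

Lemma tree_conductance_le_code delta z n : (0 < n)%N ->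
  (forall k, 0 < delta k) -> \sum_(1 <= k < n.+1) delta k = 1 ->
  (tree_conductance p r z n <= (cut_energy delta n (tree_code n z))%:E)%E.
Proof.
move=> n0 d0 d1; apply: le_trans (tree_conductance_le z n0 p_gt1 r_gt0 d0 d1) _.
rewrite lee_fin /cut_energy !big_nat; apply: ler_sum => k /andP[k0 kn].
by rewrite level_size.
Qed.

(** If [X >= tau * W], the first term is at least [W]; otherwise the second one
    is, because the exponents of [W] and [X] differ by 1. Integrated, this plays
    the role of Hoelder's inequality. *)
Lemma flow_energy_dichotomy n t (tau : R) : (0 < n)%N -> 0 < tau ->
  W n t <= tau^-1 * flow_energy n t +
    tau `^ (p - 1) * (W n t `^ p * (flow_energy n t `^ (p - 1))^-1).
Proof.
move=> n0 tau0; set X := flow_energy n t; have X0 : 0 <= X by exact: flow_energy_ge0.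
have W0 : 0 <= W n t.
  by rewrite divr_ge0 ?exprn_ge0 ?(ltW m_gt0) //; apply: gen_sum_ge0.
have [XW|XW] := leP (tau * W n t) X.
  rewrite ler_wpDr ?mulr_ge0 ?powR_ge0 ?invr_ge0 ?powR_ge0 //.
  by rewrite ler_pdivlMl.
have Wp : 0 < W n t by rewrite -(pmulr_rgt0 _ tau0) (le_lt_trans X0).
have Xp : 0 < X.
  apply: flow_energy_gt0 => //.
  by move: Wp; rewrite /norm_population pmulr_lgt0 // invr_gt0 exprn_gt0.
rewrite ler_wpDl ?mulr_ge0 ?invr_ge0 ?(ltW tau0) //.
have Y0 : 0 < X `^ (p - 1) by rewrite powR_gt0.
rewrite mulrA -(ler_pM2r Y0) mulfVK ?gt_eqF //.
have -> : W n t `^ p = W n t `^ (p - 1) * W n t.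
  by rewrite mulrC mulr_powRB1 // (lt_trans ltr01).
rewrite mulrA mulrC ler_wpM2r // -powRM ?(ltW tau0) //.
by rewrite ler_powRl ?(ltW p10) // ltW.
Qed.

End conductance_of_code.

Lemma gw_a_gt0 {R : realType} (m s r : R) n :
  0 < m -> 0 < r -> (0 < n)%N -> 0 < gw_a m s r n.
Proof.
move=> m0 r0 n0; rewrite /gw_a big_nat_recr //= ltr_wpDl ?powR_gt0 ?mulr_gt0 //.
by apply: sumr_ge0 => k _; exact: powR_ge0.
Qed.

Section cut_weight.
Context {R : realType}.
Variables (m s r : R).
Hypotheses (m_gt0 : 0 < m) (r_gt0 : 0 < r).

(** Among weights of sum 1, these minimize the mean of [cut_energy]. *)
Definition cut_weight n k : R := (m * r) `^ (- (k%:R * s)) / gw_a m s r n.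

Lemma cut_weight_gt0 n k : (0 < n)%N -> 0 < cut_weight n k.
Proof. by move=> n0; rewrite divr_gt0 ?gw_a_gt0 // powR_gt0 // mulr_gt0. Qed.

Lemma sum_cut_weight n : (0 < n)%N -> \sum_(1 <= k < n.+1) cut_weight n k = 1.
Proof. by move=> n0; rewrite -mulr_suml divff // gt_eqF // gw_a_gt0. Qed.

End cut_weight.

Section expected_energies.
Context {R : realType}.
Variables (mu : probability nat R) (m p r : R).
Hypotheses (mu0 : mu [set 0%N] = 0%E) (mu1 : (mu [set 1%N] < 1)%E).
Hypothesis (mE : gw_mean mu = m%:E).
Hypotheses (p_gt1 : 1 < p) (r_gt0 : 0 < r).
Let m_gt0 : 0 < m := lt_trans ltr01 (mean_gt1 mu0 mu1 mE).
Local Notation W := (norm_population m).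
Local Notation s := (p - 1)^-1.
Let p10 : 0 < p - 1. Proof. by rewrite subr_gt0. Qed.
Context {d : measure_display} {Omega : measurableType d}.
Variables (P : probability Omega R) (Z : seq nat -> {RV P >-> nat}).
Hypothesis HZ : gw_offspring mu Z.
Local Notation law := (tree_law Z).

Lemma integral_flow_energy_le K n :
  (forall j, (\int[law j]_t (W j t `^ (s + 1))%:E <= K%:E)%E) ->
  (\int[law n]_t (flow_energy m p r n t)%:E <= (K * gw_a m s r n)%:E)%E.
Proof.
move=> HK; rewrite nat_integral_sum; last first.
  move=> k t; rewrite !mulr_ge0 ?powR_ge0 //; apply: gen_sum_ge0 => t'; exact: powR_ge0.
rewrite /gw_a mulr_sumr -sumEFin big_nat [leRHS]big_nat.
apply: lee_sum => k /andP[k0 kn].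
have Wq0 t : 0 <= W (n - k) t `^ (s + 1) by exact: powR_ge0.
rewrite nat_integralZl; [|by rewrite mulr_ge0 ?powR_ge0|by move=> t; exact: gen_sum_ge0].
have := integral_gen_sum mE HZ k (n - k) Wq0; rewrite subnKC // => ->.
rewrite muleA -EFinM.
have -> : (r ^- k) `^ s * (m ^- k) `^ (s + 1) * m ^+ k = (m * r) `^ (- (k%:R * s)).
  rewrite -!powR_invn ?(ltW r_gt0) ?(ltW m_gt0) // -!powRrM -powR_mulrn ?(ltW m_gt0) //.
  rewrite -mulrA -powRD ?(gt_eqF m_gt0) ?implybT // powRM ?(ltW r_gt0) ?(ltW m_gt0) //.
  by rewrite mulrC; congr (_ `^ _ * _ `^ _); ring.
by rewrite [K * _]mulrC EFinM lee_wpmul2l // lee_fin powR_ge0.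
Qed.

Lemma integral_cut_energy n : (0 < n)%N ->
  (\int[law n]_t (cut_energy p r (cut_weight m s r n) n t)%:E =
   (gw_a m s r n `^ (- (p - 1)))%:E)%E.
Proof.
move=> n0; have a0 := gw_a_gt0 s m_gt0 r_gt0 n0; set a := gw_a m s r n in a0 *.
rewrite nat_integral_sum; last first.
  move=> k t; rewrite !mulr_ge0 ?powR_ge0 ?exprn_ge0 ?(ltW r_gt0) //.
  by apply: gen_sum_ge0 => t'.
transitivity (\sum_(1 <= k < n.+1) ((m * r) `^ (- (k%:R * s)) * a `^ (- p))%:E)%E.
  rewrite big_nat [RHS]big_nat; apply: eq_bigr => k /andP[k0 kn].
  rewrite nat_integralZl; last 2 first.
    by rewrite mulr_ge0 ?powR_ge0 // exprn_ge0 // ltW.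
    by move=> t; apply: gen_sum_ge0.
  have := integral_gen_sum mE HZ k (n - k) (f := fun=> 1) (fun=> ler01).
  rewrite subnKC // integral_probability_cst mule1 => ->.
  have mr0 : 0 < m * r by exact: mulr_gt0.
  rewrite -EFinM; congr EFin; rewrite mulrAC -exprMn [r * m]mulrC /cut_weight -/a.
  rewrite powRM ?invr_ge0 ?powR_ge0 ?(ltW a0) // powR_invl ?(ltW a0) // -powRN mulrA.
  congr (_ * _); rewrite -powR_mulrn ?(ltW mr0) // -powRrM -powRD ?(gt_eqF mr0) ?implybT //.
  by congr (_ `^ _); field; rewrite gt_eqF.
rewrite sumEFin -mulr_suml -/(gw_a m s r n) -/a; congr EFin.
rewrite -{1}[a]powRr1 ?(ltW a0) // -powRD ?(gt_eqF a0) ?implybT //.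
by congr (_ `^ _); ring.
Qed.

End expected_energies.

Theorem theorem1p6 (R : realType) (p : R) (hp : 1 < p)
    (mu : probability nat R)
    (hmu0 : mu [set 0%N] = 0%E)
    (hmu1 : (mu [set 1%N] < 1)%E)
    (hmean : (gw_mean mu < +oo)%E) :
  let s : R := (p - 1)^-1 in
  let q : R := p / (p - 1) in
  let m : R := fine (gw_mean mu) in
  (\int[mu]_k ((k%:R : R) `^ q)%:E < +oo)%E ->
  exists c : R, 0 < c /\
    forall (d : measure_display) (Omega : measurableType d)
      (P : probability Omega R) (Z : seq nat -> {RV P >-> nat})
      (Rn : nat -> R),
      gw_offspring mu Z ->
      (forall n : nat, (1 <= n)%N -> 0 < Rn n) ->
      let C (n : nat) (w : Omega) : \bar R :=
        tree_conductance p (Rn n) (fun v => Z v w) n in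
      let a (n : nat) : R := gw_a m s (Rn n) n in
      (forall n : nat, (1 <= n)%N ->
         ((c * a n `^ (- s^-1))%:E <= \int[P]_w C n w)%E /\
         (\int[P]_w C n w <= (a n `^ (- s^-1))%:E)%E) /\
      tight_pos P (fun n w => ((a n `^ s^-1)%:E * C n w)%E).
Proof.
move=> s q m hq.
have mE : gw_mean mu = m%:E.
  by rewrite /m fineK // ge0_fin_numE //; apply: integral_ge0 => k _; rewrite lee_fin.
have p10 : 0 < p - 1 by rewrite subr_gt0.
have s0 : 0 < s by rewrite invr_gt0.
have m0 : 0 < m := lt_trans ltr01 (mean_gt1 hmu0 hmu1 mE).
have qE : q = s + 1 by rewrite /q /s; field; rewrite gt_eqF.
rewrite qE in hq.
have [K [K0 HK]] := moment_bound hmu0 hmu1 mE s0 hq.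
have K20 : 0 < 2 * K by rewrite mulr_gt0.
exists (2^-1 * (2 * K) `^ (- (p - 1))); split.
  by rewrite mulr_gt0 ?invr_gt0 ?powR_gt0.
move=> d Omega P Z Rn HZ Rn0 C a.
have {}HK n := HK d Omega P Z n HZ.
have sV : s^-1 = p - 1 by rewrite /s invrK.
have a0 n : (1 <= n)%N -> 0 < a n by move=> n1; apply: gw_a_gt0 => //; exact: Rn0.
have C0 n w : (0 <= C n w)%E by exact: p_conductance_ge0.
have Cdet n w w' : tree_rv Z n w = tree_rv Z n w' -> C n w = C n w'.
  exact: tree_conductance_code.
pose W := norm_population m.
have W0 n t : 0 <= W n t by exact: (norm_population_ge0 hmu0 hmu1 mE).
pose X n := flow_energy m p (Rn n) n.
have X0 n t : 0 <= X n t by exact: flow_energy_ge0.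
pose A n := cut_energy p (Rn n) (cut_weight m s (Rn n) n) n.
have A0 n t : (1 <= n)%N -> 0 <= A n t.
  by move=> n1; apply: cut_energy_ge0; exact: Rn0.
have CX n w : (1 <= n)%N ->
    ((W n (tree_rv Z n w) `^ p * (X n (tree_rv Z n w) `^ (p - 1))^-1)%:E <= C n w)%E.
  by move=> n1; exact: tree_conductance_ge_code.
have CA n w : (1 <= n)%N -> (C n w <= (A n (tree_rv Z n w))%:E)%E.
  move=> n1; apply: tree_conductance_le_code => //; first exact: Rn0.
    by move=> k; apply: cut_weight_gt0 => //; exact: Rn0.
  by apply: sum_cut_weight => //; exact: Rn0.
have EX n : (1 <= n)%N -> (\int[tree_law Z n]_t (X n t)%:E <= (K * a n)%:E)%E.
  by move=> n1; exact: (integral_flow_energy_le hmu0 hmu1 mE (Rn0 n n1) HZ).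
have EA n : (1 <= n)%N -> (\int[tree_law Z n]_t (A n t)%:E = (a n `^ (- (p - 1)))%:E)%E.
  by move=> n1; exact: (integral_cut_energy hmu0 hmu1 mE hp (Rn0 n n1) HZ n1).
split=> [n n1|eps eps0]; rewrite !sV.
  split; last first.
    rewrite -EA // integral_tree_law; last by move=> t; rewrite lee_fin A0.
    apply: ge0_le_integral => //; last by move=> w _; exact: CA.
      exact: measurable_fun_determined (measurable_tree_rv Z n) (Cdet n).
    by apply: measurable_fun_determined (measurable_tree_rv Z n) _ => w w' ->.
  (* with this [tau] the first term of the dichotomy has mean at most [1/2] *)
  pose tau := 2 * K * a n; have tau0 : 0 < tau by rewrite mulr_gt0 // a0.
  pose Y t := W n t `^ p * (X n t `^ (p - 1))^-1.
  have Y0 t : 0 <= Y t by rewrite mulr_ge0 ?invr_ge0 ?powR_ge0.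
  have : (\int[tree_law Z n]_t (W n t)%:E <=
     \int[tree_law Z n]_t (tau^-1 * X n t + tau `^ (p - 1) * Y t)%:E)%E.
    apply: le_nat_integral => // t.
    exact: flow_energy_dichotomy m0 hp (Rn0 n n1) _ _ _ n1 tau0.
  rewrite (integral_norm_population hmu0 hmu1 mE n HZ) nat_integralD; last 2 first.
    by move=> t; rewrite mulr_ge0 // invr_ge0 ltW.
    by move=> t; rewrite mulr_ge0 ?powR_ge0.
  rewrite !nat_integralZl ?powR_ge0 ?invr_ge0 ?(ltW tau0) //.
  have YC : (\int[tree_law Z n]_t (Y t)%:E <= \int[P]_w C n w)%E.
    rewrite integral_tree_law; last by move=> t; rewrite lee_fin.
    apply: ge0_le_integral => //.
    - by move=> w _; rewrite lee_fin.
    - by apply: measurable_fun_determined (measurable_tree_rv Z n) _ => w w' ->.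
    - exact: measurable_fun_determined (measurable_tree_rv Z n) (Cdet n).
    - by move=> w _; exact: CX.
  have HX : (tau^-1%:E * \int[tree_law Z n]_t (X n t)%:E <= (2^-1)%:E)%E.
    apply: le_trans (lee_wpmul2l _ (EX n n1)) _; first by rewrite lee_fin invr_ge0 ltW.
    rewrite -EFinM lee_fin /tau -mulrA invfM -mulrA mulVf ?mulr1 //.
    by rewrite gt_eqF // mulr_gt0 // a0.
  move=> /le_trans/(_ (leeD HX (lee_wpmul2l _ YC))).
  rewrite lee_fin powR_ge0 => /(_ isT) H.
  have tp : 0 < tau `^ (p - 1) by rewrite powR_gt0.
  have -> : 2^-1 * (2 * K) `^ (- (p - 1)) * a n `^ (- (p - 1)) = (tau `^ (p - 1))^-1 * 2^-1.
    by rewrite -mulrA -powRM ?(ltW K20) ?(ltW (a0 n n1)) // -/tau powRN mulrC.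
  rewrite EFinM lee_pdivrMl // -leeBlDl // in H *; apply: le_trans H.
  by rewrite -EFinB lee_fin; lra.
have eps40 : 0 < eps / 4 by rewrite divr_gt0.
have [delta [delta0 Hdelta]] :=
  small_norm_population hmu0 hmu1 mE s0 K0 HZ HK eps40.
pose M := 4 / eps; have M0 : 0 < M by rewrite divr_gt0.
have ME : M^-1 = eps / 4 by rewrite invf_div.
pose lo := delta `^ p * (M * K) `^ (- (p - 1)).
have lo0 : 0 < lo by rewrite mulr_gt0 ?powR_gt0 // mulr_gt0.
exists lo, (lo + M); split => [//||n n1]; first by rewrite lerDl ltW.
set E := [set w | _].
have an0 := a0 n n1; have ap0 x : 0 < a n `^ x by rewrite powR_gt0.
(* three exceptional events: few leaves, a large energy of the uniform flow, a
   large cut bound; each has probability at most [eps / 4] *)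
pose B1 := [set t | (W n t < delta)%R].
pose B2 := [set t | (M * (K * a n) < X n t)%R].
pose B3 := [set t | (M * a n `^ (- (p - 1)) < A n t)%R].
have HB1 : (tree_law Z n B1 <= (eps / 4)%:E)%E by exact: Hdelta.
have HB2 : (tree_law Z n B2 <= (eps / 4)%:E)%E.
  have Ka0 : 0 < K * a n by rewrite mulr_gt0.
  have := nat_markov (X0 n) (mulr_gt0 M0 Ka0) (EX n n1).
  rewrite (_ : K * a n / _ = eps / 4) //.
  by rewrite invfM mulrCA mulfV ?gt_eqF // mulr1 ME.
have HB3 : (tree_law Z n B3 <= (eps / 4)%:E)%E.
  have EAn : (\int[tree_law Z n]_t (A n t)%:E <= (a n `^ (- (p - 1)))%:E)%E by rewrite EA.
  have := nat_markov (A0 n ^~ n1) (mulr_gt0 M0 (ap0 (- (p - 1)))) EAn.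
  rewrite (_ : a n `^ (- (p - 1)) / _ = eps / 4) //.
  by rewrite invfM mulrCA mulfV ?gt_eqF // mulr1 ME.
have measE : measurable E.
  apply: measurable_set_determined (measurable_tree_rv Z n) _ => w w' ww'.
  by rewrite /E /= (Cdet n w w' ww').
have EB : ~` E `<=` tree_rv Z n @^-1` (B1 `|` B2 `|` B3).
  move=> w; apply: contra_notP => /= /not_orP[/not_orP[/negP HW /negP HX] /negP HA].
  rewrite -leNgt in HW; rewrite -leNgt in HX; rewrite -leNgt in HA.
  split.
    apply: le_trans (lee_wpmul2l _ (CX n w n1)); last by rewrite lee_fin ltW.
    set t := tree_rv Z n w in HW HX *.
    have Wp : 0 < W n t by exact: lt_le_trans HW.
    have Xp : 0 < X n t.
      apply: flow_energy_gt0 => //; first exact: Rn0.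
      by move: Wp; rewrite /W /norm_population pmulr_lgt0 // invr_gt0 exprn_gt0.
    have MK0 : 0 < M * K by rewrite mulr_gt0.
    rewrite -EFinM lee_fin /lo.
    have -> : (M * K) `^ (- (p - 1)) = a n `^ (p - 1) * ((M * (K * a n)) `^ (p - 1))^-1.
      rewrite [M * (K * _)]mulrA [(M * K * a n) `^ _]powRM ?(ltW MK0) ?(ltW an0) //.
      rewrite invfM mulrCA mulfV ?gt_eqF //.
      by rewrite mulr1 powRN.
    rewrite mulrCA ler_wpM2l ?(ltW (ap0 _)) //.
    apply: ler_pM; rewrite ?powR_ge0 ?invr_ge0 ?powR_ge0 //.
      by apply: ler_powRl; rewrite ?(ltW delta0) // ltW // (lt_trans ltr01).
    rewrite lef_pV2 ?posrE ?powR_gt0 ?(mulr_gt0 M0 (mulr_gt0 K0 an0)) //.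
    by apply: ler_powRl => //; exact: ltW.
  apply: (@le_trans _ _ (M%:E)); last by rewrite lee_fin lerDr ltW.
  apply: (le_trans (lee_wpmul2l _ (CA n w n1))); first by rewrite lee_fin ltW.
  rewrite -EFinM lee_fin; apply: (le_trans (ler_wpM2l (ltW (ap0 _)) HA)).
  by rewrite powRN mulrCA mulfV ?mulr1 // gt_eqF.
rewrite -[E]setCK probability_setC; last exact: measurableC.
rewrite EFinB leeB //.
apply: (@le_trans _ _ (tree_law Z n (B1 `|` B2 `|` B3))).
  apply: le_measure; rewrite ?inE //; first exact: measurableC.
  by rewrite -[X in measurable X]setTI; exact: measurable_tree_rv.
apply: (@le_trans _ _ (tree_law Z n (B1 `|` B2) + tree_law Z n B3)%E).
  exact: measureU2.
apply: (@le_trans _ _ (tree_law Z n B1 + tree_law Z n B2 + tree_law Z n B3)%E).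
  by rewrite leeD2r //; exact: measureU2.
apply: (le_trans (leeD (leeD HB1 HB2) HB3)).
by rewrite -!EFinD lee_fin; lra.
Qed.
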